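(* Let $\mathcal{C},\mathcal{D}$ be 2-categories. If $\mathcal{C}$ has left duals and $\mathcal{D}$ has right duals, then the 2-category $\mathrm{Fun}(\mathcal{C},\mathcal{D})$ has right duals. Likewise, if $\mathcal{C}$ has right duals and $\mathcal{D}$ has left duals, then $\mathrm{Fun}(\mathcal{C},\mathcal{D})$ has left duals.
   Context: All 2-categories are taken to be strict (every weak 2-category is equivalent to a strict one). 1-morphisms compose from left to right: for $X:r\to s$ and $Y:s\to t$ the composite is $X\otimes Y:r\to t$; $\otimes$ also denotes horizontal composition of 2-morphisms, and $\circ$ denotes vertical composition. A pseudofunctor $F:\mathcal{C}\to\mathcal{D}$ consists of an assignment $r\mapsto F(r)$ on objects, functors $\mathcal{C}(r,s)\to\mathcal{D}(F(r),F(s))$ on hom-categories, and invertible 2-morphisms $m^F_{X,Y}:F(X)\otimes F(Y)\to F(X\otimes Y)$ and $u^F_r:\mathrm{id}_{F(r)}\to F(\mathrm{id}_r)$ satisfying the usual naturality, associativity and unitality conditions. A pseudonatural transformation $\alpha:F\to G$ between pseudofunctors $F,G:\mathcal{C}\to\mathcal{D}$ consists of a 1-morphism $\alpha_r:F(r)\to G(r)$ for every object $r$ and an invertible 2-morphism $\alpha_X:F(X)\otimes\alpha_s\to\alpha_r\otimes G(X)$ for every 1-morphism $X:r\to s$, such that: (naturality) $(\mathrm{id}_{\alpha_r}\otimes G(f))\circ\alpha_X=\alpha_Y\circ(F(f)\otimes\mathrm{id}_{\alpha_s})$ for all $f:X\to Y$; (monoidality) $\alpha_{X\otimes Y}\circ(m^F_{X,Y}\otimes\mathrm{id}_{\alpha_t})=(\mathrm{id}_{\alpha_r}\otimes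 m^G_{X,Y})\circ(\alpha_X\otimes\mathrm{id}_{G(Y)})\circ(\mathrm{id}_{F(X)}\otimes\alpha_Y)$ for $X:r\to s$, $Y:s\to t$, and $\alpha_{\mathrm{id}_r}\circ(u^F_r\otimes\mathrm{id}_{\alpha_r})=\mathrm{id}_{\alpha_r}\otimes u^G_r$. Composition of $\alpha:F\to G$ and $\beta:G\to H$ is $(\alpha\otimes\beta)_r=\alpha_r\otimes\beta_r$, $(\alpha\otimes\beta)_X=(\mathrm{id}_{\alpha_r}\otimes\beta_X)\circ(\alpha_X\otimes\mathrm{id}_{\beta_s})$. A modification $f:\alpha\to\beta$ between $\alpha,\beta:F\to G$ is a family of 2-morphisms $f_r:\alpha_r\to\beta_r$ with $\beta_X\circ(\mathrm{id}_{F(X)}\otimes f_s)=(f_r\otimes\mathrm{id}_{G(X)})\circ\alpha_X$ for all $X:r\to s$. $\mathrm{Fun}(\mathcal{C},\mathcal{D})$ is the 2-category of pseudofunctors $\mathcal{C}\to\mathcal{D}$, pseudonatural transformations and modifications (composed componentwise). A right dual of a 1-morphism $X:r\to s$ is a triple $[X^*,\eta,\epsilon]$ with $X^*:s\to r$, $\eta:\mathrm{id}_s\to X^*\otimes X$, $\epsilon:X\otimes X^*\to\mathrm{id}_r$ satisfying the snake equations $(\epsilon\otimes\mathrm{id}_X)\circ(\mathrm{id}_X\otimes\eta)=\mathrm{id}_X$ and $(\mathrm{id}_{X^*}\otimes\epsilon)\circ(\eta\otimes\mathrm{id}_{X^*})=\mathrm{id}_{X^*}$. A left dual is a triple $[{}^*X,\eta,\epsilon]$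 with ${}^*X:s\to r$, $\eta:\mathrm{id}_r\to X\otimes{}^*X$, $\epsilon:{}^*X\otimes X\to\mathrm{id}_s$ satisfying the analogous snake equations. A 2-category has right (resp. left) duals if every 1-morphism has a chosen right (resp. left) dual. *)

(* Defs.v *)
From Stdlib Require Import Setoid FunctionalExtensionality ProofIrrelevance.

Set Implicit Arguments.
Unset Strict Implicit.
Unset Printing Implicit Defensive.

Declare Scope twocat_scope.
Delimit Scope twocat_scope with twocat.
Local Open Scope twocat_scope.

(* 1-morphisms compose from left to right; [vcomp g f] is "g after f". *)
Record TwoCatData := {
  ob :> Type;
  mor : ob -> ob -> Type;
  cell : forall {r s : ob}, mor r s -> mor r s -> Type;
  id1 : forall r : ob, mor r r;
  comp1 : forall {r s t : ob}, mor r s -> mor s t -> mor r t;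
  id2 : forall {r s : ob} (X : mor r s), cell X X;
  vcomp : forall {r s : ob} {X Y Z : mor r s}, cell Y Z -> cell X Y -> cell X Z;
  hcomp : forall {r s t : ob} {X X' : mor r s} {Y Y' : mor s t},
      cell X X' -> cell Y Y' -> cell (comp1 X Y) (comp1 X' Y')
}.

Arguments mor {t0} _ _ : rename.
Arguments cell {t0 r s} _ _ : rename.
Arguments id1 {t0} _ : rename.
Arguments comp1 {t0 r s t} _ _ : rename.
Arguments id2 {t0 r s} _ : rename.
Arguments vcomp {t0 r s X Y Z} _ _ : rename.
Arguments hcomp {t0 r s t X X' Y Y'} _ _ : rename.

Notation "X ⊗ Y" := (comp1 X Y) (at level 40, left associativity) : twocat_scope.
Notation "X ⇒ Y" := (cell X Y) (at level 70, no associativity) : twocat_scope.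
Notation "f ⊠ g" := (hcomp f g) (at level 40, left associativity) : twocat_scope.
Notation "g ∘ f" := (vcomp g f) (at level 50, left associativity) : twocat_scope.

(* The identity 2-morphism between two equal 1-morphisms.  Strictness makes
   [X ⊗ (Y ⊗ Z)] and [(X ⊗ Y) ⊗ Z] equal but not convertible, so composites
   that are written without brackets on paper contain such a [coe]. *)
Definition coe {C : TwoCatData} {r s : C} {X Y : mor r s} (e : X = Y) : X ⇒ Y :=
  match e in _ = Z return X ⇒ Z with eq_refl => id2 X end.

(* A strict 2-category.  The pentagon and triangle identities for the [coe]s are
   automatic, by proof irrelevance for equalities of 1-morphisms. *)
Record TwoCat := {
  tcd :> TwoCatData;
  vcomp_id_l : forall (r s : tcd) (X Y : mor r s) (f : X ⇒ Y), id2 Y ∘ f = f;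
  vcomp_id_r : forall (r s : tcd) (X Y : mor r s) (f : X ⇒ Y), f ∘ id2 X = f;
  vcomp_assoc : forall (r s : tcd) (X Y Z W : mor r s)
      (h : Z ⇒ W) (g : Y ⇒ Z) (f : X ⇒ Y), h ∘ (g ∘ f) = (h ∘ g) ∘ f;
  hcomp_id : forall (r s t : tcd) (X : mor r s) (Y : mor s t),
      id2 X ⊠ id2 Y = id2 (X ⊗ Y);
  hcomp_vcomp : forall (r s t : tcd) (X X' X'' : mor r s) (Y Y' Y'' : mor s t)
      (f : X ⇒ X') (f' : X' ⇒ X'') (g : Y ⇒ Y') (g' : Y' ⇒ Y''),
      (f' ∘ f) ⊠ (g' ∘ g) = (f' ⊠ g') ∘ (f ⊠ g);
  comp1_id_l : forall (r s : tcd) (X : mor r s), id1 r ⊗ X = X;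
  comp1_id_r : forall (r s : tcd) (X : mor r s), X ⊗ id1 s = X;
  comp1_assoc : forall (r s t u : tcd) (X : mor r s) (Y : mor s t) (Z : mor t u),
      X ⊗ (Y ⊗ Z) = (X ⊗ Y) ⊗ Z;
  hcomp_id_l : forall (r s : tcd) (X Y : mor r s) (f : X ⇒ Y),
      coe (comp1_id_l Y) ∘ (id2 (id1 r) ⊠ f) = f ∘ coe (comp1_id_l X);
  hcomp_id_r : forall (r s : tcd) (X Y : mor r s) (f : X ⇒ Y),
      coe (comp1_id_r Y) ∘ (f ⊠ id2 (id1 s)) = f ∘ coe (comp1_id_r X);
  hcomp_assoc : forall (r s t u : tcd) (X X' : mor r s) (Y Y' : mor s t)
      (Z Z' : mor t u) (f : X ⇒ X') (g : Y ⇒ Y') (h : Z ⇒ Z'),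
      coe (comp1_assoc X' Y' Z') ∘ (f ⊠ (g ⊠ h))
      = ((f ⊠ g) ⊠ h) ∘ coe (comp1_assoc X Y Z)
}.

Section StrictCells.
Context {C : TwoCat}.

Definition asc {r s t u : C} (X : mor r s) (Y : mor s t) (Z : mor t u) :
  X ⊗ (Y ⊗ Z) ⇒ (X ⊗ Y) ⊗ Z := coe (comp1_assoc X Y Z).
Definition asci {r s t u : C} (X : mor r s) (Y : mor s t) (Z : mor t u) :
  (X ⊗ Y) ⊗ Z ⇒ X ⊗ (Y ⊗ Z) := coe (eq_sym (comp1_assoc X Y Z)).
Definition lun {r s : C} (X : mor r s) : id1 r ⊗ X ⇒ X := coe (comp1_id_l X).
Definition luni {r s : C} (X : mor r s) : X ⇒ id1 r ⊗ X := coe (eq_sym (comp1_id_l X)).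
Definition run {r s : C} (X : mor r s) : X ⊗ id1 s ⇒ X := coe (comp1_id_r X).
Definition runi {r s : C} (X : mor r s) : X ⇒ X ⊗ id1 s := coe (eq_sym (comp1_id_r X)).

Definition invertible {r s : C} {X Y : mor r s} (f : X ⇒ Y) : Prop :=
  exists g : Y ⇒ X, g ∘ f = id2 X /\ f ∘ g = id2 Y.

End StrictCells.

Record RightDual {C : TwoCat} {r s : C} (X : mor r s) := {
  rdual : mor s r;
  rd_eta : id1 s ⇒ rdual ⊗ X;
  rd_eps : X ⊗ rdual ⇒ id1 r;
  rd_snake : lun X ∘ (rd_eps ⊠ id2 X) ∘ asc X rdual X ∘ (id2 X ⊠ rd_eta) ∘ runi X
             = id2 X;
  rd_snake' : run rdual ∘ (id2 rdual ⊠ rd_eps) ∘ asci rdual X rdual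
              ∘ (rd_eta ⊠ id2 rdual) ∘ luni rdual = id2 rdual
}.

Record LeftDual {C : TwoCat} {r s : C} (X : mor r s) := {
  ldual : mor s r;
  ld_eta : id1 r ⇒ X ⊗ ldual;
  ld_eps : ldual ⊗ X ⇒ id1 s;
  ld_snake : run X ∘ (id2 X ⊠ ld_eps) ∘ asci X ldual X ∘ (ld_eta ⊠ id2 X) ∘ luni X
             = id2 X;
  ld_snake' : lun ldual ∘ (ld_eps ⊠ id2 ldual) ∘ asc ldual X ldual
              ∘ (id2 ldual ⊠ ld_eta) ∘ runi ldual = id2 ldual
}.

(* [inhabited] of a dependent function: a simultaneous choice of duals for all
   1-morphisms exists. *)
Definition has_right_duals (C : TwoCat) : Prop :=
  inhabited (forall (r s : C) (X : mor r s), RightDual X).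

Definition has_left_duals (C : TwoCat) : Prop :=
  inhabited (forall (r s : C) (X : mor r s), LeftDual X).

Record PseudoFunctor (C D : TwoCat) := {
  F0 :> C -> D;
  F1 : forall {r s : C}, mor r s -> mor (F0 r) (F0 s);
  F2 : forall {r s : C} {X Y : mor r s}, X ⇒ Y -> F1 X ⇒ F1 Y;
  Fm : forall {r s t : C} (X : mor r s) (Y : mor s t), F1 X ⊗ F1 Y ⇒ F1 (X ⊗ Y);
  Fu : forall r : C, id1 (F0 r) ⇒ F1 (id1 r);
  F2_id : forall (r s : C) (X : mor r s), F2 (id2 X) = id2 (F1 X);
  F2_vcomp : forall (r s : C) (X Y Z : mor r s) (g : Y ⇒ Z) (f : X ⇒ Y),
      F2 (g ∘ f) = F2 g ∘ F2 f;
  Fm_inv : forall (r s t : C) (X : mor r s) (Y : mor s t), invertible (Fm X Y);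
  Fu_inv : forall r : C, invertible (Fu r);
  Fm_nat : forall (r s t : C) (X X' : mor r s) (Y Y' : mor s t)
      (f : X ⇒ X') (g : Y ⇒ Y'),
      F2 (f ⊠ g) ∘ Fm X Y = Fm X' Y' ∘ (F2 f ⊠ F2 g);
  Fm_assoc : forall (r s t u : C) (X : mor r s) (Y : mor s t) (Z : mor t u),
      Fm (X ⊗ Y) Z ∘ (Fm X Y ⊠ id2 (F1 Z)) ∘ asc (F1 X) (F1 Y) (F1 Z)
      = F2 (asc X Y Z) ∘ Fm X (Y ⊗ Z) ∘ (id2 (F1 X) ⊠ Fm Y Z);
  Fm_unit_l : forall (r s : C) (X : mor r s),
      F2 (lun X) ∘ Fm (id1 r) X ∘ (Fu r ⊠ id2 (F1 X)) = lun (F1 X);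
  Fm_unit_r : forall (r s : C) (X : mor r s),
      F2 (run X) ∘ Fm X (id1 s) ∘ (id2 (F1 X) ⊠ Fu s) = run (F1 X)
}.

Arguments F1 {C D} _ {r s} _.
Arguments F2 {C D} _ {r s X Y} _.
Arguments Fm {C D} _ {r s t} _ _.
Arguments Fu {C D} _ _.

Record PseudoNat {C D : TwoCat} (F G : PseudoFunctor C D) := {
  N1 :> forall r : C, mor (F r) (G r);
  N2 : forall {r s : C} (X : mor r s), F1 F X ⊗ N1 s ⇒ N1 r ⊗ F1 G X;
  N2_inv : forall (r s : C) (X : mor r s), invertible (N2 X);
  N2_nat : forall (r s : C) (X Y : mor r s) (f : X ⇒ Y),
      (id2 (N1 r) ⊠ F2 G f) ∘ N2 X = N2 Y ∘ (F2 F f ⊠ id2 (N1 s));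
  N2_comp : forall (r s t : C) (X : mor r s) (Y : mor s t),
      N2 (X ⊗ Y) ∘ (Fm F X Y ⊠ id2 (N1 t))
      = (id2 (N1 r) ⊠ Fm G X Y) ∘ asci (N1 r) (F1 G X) (F1 G Y)
        ∘ (N2 X ⊠ id2 (F1 G Y)) ∘ asc (F1 F X) (N1 s) (F1 G Y)
        ∘ (id2 (F1 F X) ⊠ N2 Y) ∘ asci (F1 F X) (F1 F Y) (N1 t);
  N2_unit : forall r : C,
      N2 (id1 r) ∘ (Fu F r ⊠ id2 (N1 r))
      = (id2 (N1 r) ⊠ Fu G r) ∘ runi (N1 r) ∘ lun (N1 r)
}.

Arguments N2 {C D F G} _ {r s} _.

Record Modification {C D : TwoCat} {F G : PseudoFunctor C D} (a b : PseudoNat F G) := {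
  M2 :> forall r : C, a r ⇒ b r;
  M2_nat : forall (r s : C) (X : mor r s),
      N2 b X ∘ (id2 (F1 F X) ⊠ M2 s) = (M2 r ⊠ id2 (F1 G X)) ∘ N2 a X
}.

Section CoeLemmas.
Context {C : TwoCat}.
Implicit Types r s t u : C.

Lemma coe_irrel r s (X Y : mor r s) (p q : X = Y) : coe p = coe q.
Proof. now rewrite (proof_irrelevance _ p q). Qed.

Lemma coe_id r s (X : mor r s) (p : X = X) : coe p = id2 X.
Proof. now rewrite (proof_irrelevance _ p eq_refl). Qed.

Lemma coe_vcomp r s (X Y Z : mor r s) (q : Y = Z) (p : X = Y) :
  coe q ∘ coe p = coe (eq_trans p q).
Proof. destruct q; simpl; apply vcomp_id_l. Qed.

Lemma coe_vcomp_id r s (X Y : mor r s) (q : Y = X) (p : X = Y) : coe q ∘ coe p = id2 X.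
Proof. rewrite coe_vcomp; apply coe_id. Qed.

Lemma coe_invertible r s (X Y : mor r s) (p : X = Y) : invertible (coe p).
Proof. exists (coe (eq_sym p)); split; apply coe_vcomp_id. Qed.

Lemma coe_rwhisker r s t (X Y : mor r s) (Z : mor s t) (p : X = Y) :
  coe p ⊠ id2 Z = coe (f_equal (fun W => W ⊗ Z) p).
Proof. destruct p; simpl; apply hcomp_id. Qed.

Lemma coe_lwhisker r s t (X : mor r s) (Y Z : mor s t) (p : Y = Z) :
  id2 X ⊠ coe p = coe (f_equal (fun W => X ⊗ W) p).
Proof. destruct p; simpl; apply hcomp_id. Qed.

Lemma lwhisker_vcomp r s t (X : mor r s) (Y Y' Y'' : mor s t) (g : Y' ⇒ Y'') (f : Y ⇒ Y') :
  id2 X ⊠ (g ∘ f) = (id2 X ⊠ g) ∘ (id2 X ⊠ f).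
Proof. now rewrite <- hcomp_vcomp, vcomp_id_l. Qed.

Lemma rwhisker_vcomp r s t (Y : mor s t) (X X' X'' : mor r s) (g : X' ⇒ X'') (f : X ⇒ X') :
  (g ∘ f) ⊠ id2 Y = (g ⊠ id2 Y) ∘ (f ⊠ id2 Y).
Proof. now rewrite <- hcomp_vcomp, vcomp_id_l. Qed.

Lemma whisker_exchange r s t (X X' : mor r s) (Y Y' : mor s t) (f : X ⇒ X') (g : Y ⇒ Y') :
  (id2 X' ⊠ g) ∘ (f ⊠ id2 Y) = (f ⊠ id2 Y') ∘ (id2 X ⊠ g).
Proof. now rewrite <- !hcomp_vcomp, !vcomp_id_l, !vcomp_id_r. Qed.

Lemma asc_nat r s t u (X X' : mor r s) (Y Y' : mor s t) (Z Z' : mor t u)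
  (f : X ⇒ X') (g : Y ⇒ Y') (h : Z ⇒ Z') :
  asc X' Y' Z' ∘ (f ⊠ (g ⊠ h)) = ((f ⊠ g) ⊠ h) ∘ asc X Y Z.
Proof. apply hcomp_assoc. Qed.

Lemma asci_nat r s t u (X X' : mor r s) (Y Y' : mor s t) (Z Z' : mor t u)
  (f : X ⇒ X') (g : Y ⇒ Y') (h : Z ⇒ Z') :
  asci X' Y' Z' ∘ ((f ⊠ g) ⊠ h) = (f ⊠ (g ⊠ h)) ∘ asci X Y Z.
Proof.
  rewrite <- (vcomp_id_r ((f ⊠ g) ⊠ h)).
  rewrite <- (coe_vcomp_id (comp1_assoc X Y Z) (eq_sym (comp1_assoc X Y Z))).
  rewrite (vcomp_assoc _ (coe (comp1_assoc X Y Z))), <- hcomp_assoc.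
  unfold asci; rewrite !vcomp_assoc, coe_vcomp_id, vcomp_id_l; reflexivity.
Qed.

Lemma luni_nat r s (X Y : mor r s) (f : X ⇒ Y) : luni Y ∘ f = (id2 (id1 r) ⊠ f) ∘ luni X.
Proof.
  rewrite <- (vcomp_id_r f) at 1.
  rewrite <- (coe_vcomp_id (comp1_id_l X) (eq_sym (comp1_id_l X))).
  rewrite (vcomp_assoc f), <- hcomp_id_l.
  unfold luni; rewrite !vcomp_assoc, coe_vcomp_id, vcomp_id_l; reflexivity.
Qed.

Lemma runi_nat r s (X Y : mor r s) (f : X ⇒ Y) : runi Y ∘ f = (f ⊠ id2 (id1 s)) ∘ runi X.
Proof.
  rewrite <- (vcomp_id_r f) at 1.
  rewrite <- (coe_vcomp_id (comp1_id_r X) (eq_sym (comp1_id_r X))).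
  rewrite (vcomp_assoc f), <- hcomp_id_r.
  unfold runi; rewrite !vcomp_assoc, coe_vcomp_id, vcomp_id_l; reflexivity.
Qed.

Lemma invertible_vcomp r s (X Y Z : mor r s) (g : Y ⇒ Z) (f : X ⇒ Y) :
  invertible g -> invertible f -> invertible (g ∘ f).
Proof.
  intros [g' [g1 g2]] [f' [f1 f2]]; exists (f' ∘ g'); split.
  - rewrite vcomp_assoc, <- (vcomp_assoc f'), g1, vcomp_id_r; exact f1.
  - rewrite vcomp_assoc, <- (vcomp_assoc g), f2, vcomp_id_r; exact g2.
Qed.

Lemma invertible_id r s (X : mor r s) : invertible (id2 X).
Proof. exists (id2 X); split; apply vcomp_id_l. Qed.

Lemma invertible_hcomp r s t (X X' : mor r s) (Y Y' : mor s t) (f : X ⇒ X') (g : Y ⇒ Y') :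
  invertible f -> invertible g -> invertible (f ⊠ g).
Proof.
  intros [f' [f1 f2]] [g' [g1 g2]]; exists (f' ⊠ g'); split;
    now rewrite <- hcomp_vcomp, ?f1, ?g1, ?f2, ?g2, hcomp_id.
Qed.

End CoeLemmas.

Lemma slide {C : TwoCat} {r s : C} {X Y Y' Z W : mor r s} {g : Y ⇒ Z} {f : X ⇒ Y}
  {g' : Y' ⇒ Z} {f' : X ⇒ Y'} (e : g ∘ f = g' ∘ f') (k : W ⇒ X) :
  g ∘ (f ∘ k) = g' ∘ (f' ∘ k).
Proof. now rewrite !vcomp_assoc, e. Qed.

Lemma slide1 {C : TwoCat} {r s : C} {X Y Z W : mor r s} {g : Y ⇒ Z} {f : X ⇒ Y}
  {h : X ⇒ Z} (e : g ∘ f = h) (k : W ⇒ X) : g ∘ (f ∘ k) = h ∘ k.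
Proof. now rewrite vcomp_assoc, e. Qed.

Lemma hcomp_split {C : TwoCat} {r s t : C} {X X' : mor r s} {Y Y' : mor s t}
  (f : X ⇒ X') (g : Y ⇒ Y') : f ⊠ g = (f ⊠ id2 Y') ∘ (id2 X ⊠ g).
Proof. now rewrite <- hcomp_vcomp, vcomp_id_l, vcomp_id_r. Qed.

Lemma hcomp_split' {C : TwoCat} {r s t : C} {X X' : mor r s} {Y Y' : mor s t}
  (f : X ⇒ X') (g : Y ⇒ Y') : f ⊠ g = (id2 X' ⊠ g) ∘ (f ⊠ id2 Y).
Proof. now rewrite <- hcomp_vcomp, vcomp_id_l, vcomp_id_r. Qed.

Ltac rassoc := rewrite <- ?vcomp_assoc.

Ltac coe_solve :=
  unfold asc, asci, lun, luni, run, runi;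
  rewrite ?lwhisker_vcomp, ?rwhisker_vcomp, ?lwhisker_vcomp, ?rwhisker_vcomp,
    ?coe_rwhisker, ?coe_lwhisker, ?coe_rwhisker, ?coe_lwhisker;
  rassoc; rewrite ?coe_vcomp;
  solve [ reflexivity | apply coe_irrel | apply coe_id | symmetry; apply coe_id ].

Lemma hcomp_unit_l {C : TwoCat} {r s : C} {X Y : mor r s} (f : X ⇒ Y) :
  id2 (id1 r) ⊠ f = luni Y ∘ (f ∘ lun X).
Proof.
  rewrite vcomp_assoc, luni_nat; rassoc; unfold lun, luni.
  now rewrite coe_vcomp_id, vcomp_id_r.
Qed.

Lemma hcomp_unit_r {C : TwoCat} {r s : C} {X Y : mor r s} (f : X ⇒ Y) :
  f ⊠ id2 (id1 s) = runi Y ∘ (f ∘ run X).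
Proof.
  rewrite vcomp_assoc, runi_nat; rassoc; unfold run, runi.
  now rewrite coe_vcomp_id, vcomp_id_r.
Qed.

Lemma hcomp_conj_l {C : TwoCat} {r s t u : C} {X X' : mor r s} {Y Y' : mor s t}
  {Z Z' : mor t u} (f : X ⇒ X') (g : Y ⇒ Y') (h : Z ⇒ Z') :
  (f ⊠ g) ⊠ h = asc X' Y' Z' ∘ ((f ⊠ (g ⊠ h)) ∘ asci X Y Z).
Proof.
  rewrite vcomp_assoc, asc_nat; rassoc; unfold asc, asci.
  now rewrite coe_vcomp_id, vcomp_id_r.
Qed.

Lemma hcomp_conj_r {C : TwoCat} {r s t u : C} {X X' : mor r s} {Y Y' : mor s t}
  {Z Z' : mor t u} (f : X ⇒ X') (g : Y ⇒ Y') (h : Z ⇒ Z') :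
  f ⊠ (g ⊠ h) = asci X' Y' Z' ∘ (((f ⊠ g) ⊠ h) ∘ asc X Y Z).
Proof.
  rewrite vcomp_assoc, asci_nat; rassoc; unfold asc, asci.
  now rewrite coe_vcomp_id, vcomp_id_r.
Qed.

Ltac coe_norm :=
  unfold asc, asci, lun, luni, run, runi;
  rewrite ?lwhisker_vcomp, ?rwhisker_vcomp, ?lwhisker_vcomp, ?rwhisker_vcomp,
    ?coe_rwhisker, ?coe_lwhisker, ?coe_rwhisker, ?coe_lwhisker;
  rassoc;
  repeat (rewrite (slide1 (coe_vcomp _ _)) || rewrite coe_vcomp).

Section FunCat.
Context {C D : TwoCat}.
Implicit Types F G H K : PseudoFunctor C D.

Definition nat_id2 F {r s : C} (X : mor r s) :
  F1 F X ⊗ id1 (F s) ⇒ id1 (F r) ⊗ F1 F X := luni (F1 F X) ∘ run (F1 F X).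

Lemma nat_id2_slide F {r s : C} (X : mor r s) (Y : mor (F r) (F s)) (f : Y ⇒ F1 F X) :
  nat_id2 F X ∘ (f ⊠ id2 (id1 (F s))) = (id2 (id1 (F r)) ⊠ f) ∘ (luni Y ∘ run Y).
Proof.
  unfold nat_id2, run; rassoc; rewrite hcomp_id_r, vcomp_assoc, luni_nat; now rassoc.
Qed.

Definition nat_id F : PseudoNat F F.
Proof.
  refine {| N1 := fun r => id1 (F r); N2 := fun r s X => nat_id2 F X |}.
  - intros r s X; unfold nat_id2, luni, run; rewrite coe_vcomp; apply coe_invertible.
  - intros r s X Y f; now rewrite nat_id2_slide.
  - intros r s t X Y; rewrite nat_id2_slide; rassoc; f_equal; unfold nat_id2; coe_solve.
  - intros r; rewrite nat_id2_slide; rassoc; f_equal; coe_solve.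
Defined.

Definition nat_comp2 {F G H} (a : PseudoNat F G) (b : PseudoNat G H)
  {r s : C} (X : mor r s) : F1 F X ⊗ (a s ⊗ b s) ⇒ (a r ⊗ b r) ⊗ F1 H X :=
  asc (a r) (b r) (F1 H X) ∘ (id2 (a r) ⊠ N2 b X) ∘ asci (a r) (F1 G X) (b s)
  ∘ (N2 a X ⊠ id2 (b s)) ∘ asc (F1 F X) (a s) (b s).

Definition nat_comp {F G H} (a : PseudoNat F G) (b : PseudoNat G H) : PseudoNat F H.
Proof.
  refine {| N1 := fun r => a r ⊗ b r; N2 := fun r s X => nat_comp2 a b X |}.
  - intros r s X; unfold nat_comp2, asc, asci.
    repeat apply invertible_vcomp; try apply coe_invertible;
      apply invertible_hcomp; try apply invertible_id; apply N2_inv.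
  - intros r s X Y f; unfold nat_comp2; rassoc.
    rewrite <- hcomp_id, (slide (eq_sym (asc_nat (id2 (a r)) (id2 (b r)) (F2 H f)))).
    f_equal. rewrite <- (hcomp_id (a s) (b s)), (asc_nat (F2 F f)).
    rewrite (slide1 (eq_sym (lwhisker_vcomp (a r) _ _))), N2_nat, lwhisker_vcomp.
    rassoc; f_equal.
    rewrite (slide (eq_sym (asci_nat (id2 (a r)) (F2 G f) (id2 (b s))))); f_equal.
    rewrite !(slide1 (eq_sym (rwhisker_vcomp (b s) _ _))), N2_nat; reflexivity.
  - intros r s t X Y; unfold nat_comp2; rassoc.
    rewrite <- hcomp_id, (asc_nat (Fm F X Y)).
    rewrite (slide1 (eq_sym (rwhisker_vcomp (b t) _ _))), N2_comp.
    rewrite !rwhisker_vcomp; rassoc.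
    rewrite (slide (asci_nat (id2 (a r)) (Fm G X Y) (id2 (b t)))).
    rewrite (slide1 (eq_sym (lwhisker_vcomp (a r) _ _))), N2_comp.
    rewrite !lwhisker_vcomp; rassoc.
    rewrite (slide (asc_nat (id2 (a r)) (id2 (b r)) (Fm H X Y))), (hcomp_id (a r)).
    f_equal.
    rewrite ?rwhisker_vcomp, ?lwhisker_vcomp.
    rewrite (hcomp_conj_l (N2 a X) (id2 (F1 G Y))), (hcomp_conj_l (N2 a X) (id2 (b s))).
    rewrite (hcomp_conj_l (id2 (a r)) (N2 b X)).
    rewrite (hcomp_conj_l (id2 (F1 F X)) (N2 a Y)).
    rewrite (hcomp_conj_r (id2 (a r)) (id2 (F1 G X))).
    rewrite (hcomp_conj_r (id2 (F1 F X)) (id2 (a s))).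
    rewrite !hcomp_id.
    coe_norm.
    rewrite !coe_id, !vcomp_id_l, (slide (whisker_exchange (N2 a X) (N2 b Y))).
    repeat (apply (f_equal2 vcomp); [reflexivity || apply coe_irrel |]); apply coe_irrel.
  - intros r; unfold nat_comp2; rassoc.
    rewrite <- (hcomp_id (a r) (b r)), (asc_nat (Fu F r)).
    rewrite (slide1 (eq_sym (rwhisker_vcomp (b r) _ _))), N2_unit.
    rewrite !rwhisker_vcomp; rassoc.
    rewrite (slide (asci_nat (id2 (a r)) (Fu G r) (id2 (b r)))).
    rewrite (slide1 (eq_sym (lwhisker_vcomp (a r) _ _))), N2_unit.
    rewrite !lwhisker_vcomp; rassoc.
    rewrite (slide (asc_nat (id2 (a r)) (id2 (b r)) (Fu H r))).
    f_equal; coe_solve.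
Defined.

Lemma nat_ext F G (a b : PseudoNat F G) (e : forall r, a r = b r) :
  (forall (r s : C) (X : mor r s),
      N2 b X ∘ (id2 (F1 F X) ⊠ coe (e s)) = (coe (e r) ⊠ id2 (F1 G X)) ∘ N2 a X) ->
  a = b.
Proof.
  destruct a as [a1 a2 ai an ac au], b as [b1 b2 bi bn bc bu]; simpl in *; intros h.
  assert (E : a1 = b1) by (extensionality r; apply e).
  destruct E.
  assert (E : a2 = b2).
  { extensionality r; extensionality s; extensionality X; specialize (h r s X).
    rewrite !coe_id, !hcomp_id, vcomp_id_l, vcomp_id_r in h; now symmetry. }
  destruct E; f_equal; apply proof_irrelevance.
Qed.

Lemma mod_ext F G (a b : PseudoNat F G) (f g : Modification a b) :
  (forall r, f r = g r) -> f = g.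
Proof.
  destruct f as [f hf], g as [g hg]; simpl; intros h.
  assert (E : f = g) by (extensionality r; apply h).
  destruct E; f_equal; apply proof_irrelevance.
Qed.

Definition mod_id {F G} (a : PseudoNat F G) : Modification a a.
Proof.
  refine {| M2 := fun r => id2 (a r) |}.
  intros r s X; now rewrite !hcomp_id, vcomp_id_l, vcomp_id_r.
Defined.

Definition mod_vcomp {F G} {a b c : PseudoNat F G}
  (g : Modification b c) (f : Modification a b) : Modification a c.
Proof.
  refine {| M2 := fun r => g r ∘ f r |}.
  intros r s X.
  rewrite lwhisker_vcomp, rwhisker_vcomp, vcomp_assoc, M2_nat; rassoc.
  now rewrite M2_nat.
Defined.

Definition mod_hcomp {F G H} {a a' : PseudoNat F G} {b b' : PseudoNat G H}
  (f : Modification a a') (g : Modification b b') :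
  Modification (nat_comp a b) (nat_comp a' b').
Proof.
  refine {| M2 := fun r => f r ⊠ g r : nat_comp a b r ⇒ nat_comp a' b' r |}.
  intros r s X; simpl; unfold nat_comp2; rassoc.
  rewrite (asc_nat (id2 (F1 F X)) (f s) (g s)).
  assert (E : (N2 a' X ⊠ id2 (b' s)) ∘ ((id2 (F1 F X) ⊠ f s) ⊠ g s)
              = ((f r ⊠ id2 (F1 G X)) ⊠ g s) ∘ (N2 a X ⊠ id2 (b s))).
  { now rewrite <- !hcomp_vcomp, M2_nat, vcomp_id_l, vcomp_id_r. }
  rewrite (slide E), (slide (asci_nat (f r) (id2 (F1 G X)) (g s))); clear E.
  assert (E : (id2 (a' r) ⊠ N2 b' X) ∘ (f r ⊠ (id2 (F1 G X) ⊠ g s))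
              = (f r ⊠ (g r ⊠ id2 (F1 H X))) ∘ (id2 (a r) ⊠ N2 b X)).
  { now rewrite <- !hcomp_vcomp, M2_nat, vcomp_id_l, vcomp_id_r. }
  now rewrite (slide E), (slide (asc_nat (f r) (g r) (id2 (F1 H X)))).
Defined.

Lemma nat_comp_id_l F G (a : PseudoNat F G) : nat_comp (nat_id F) a = a.
Proof.
  apply nat_ext with (e := fun r => comp1_id_l (a r) : nat_comp (nat_id F) a r = a r).
  intros r s X; simpl; unfold nat_comp2; simpl; unfold nat_id2; simpl.
  rewrite hcomp_unit_l; simpl; coe_norm.
  rewrite coe_id, vcomp_id_l; f_equal; apply coe_irrel.
Qed.

Lemma nat_comp_id_r F G (a : PseudoNat F G) : nat_comp a (nat_id G) = a.
Proof.
  apply nat_ext with (e := fun r => comp1_id_r (a r) : nat_comp a (nat_id G) r = a r).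
  intros r s X; simpl; unfold nat_comp2; simpl; unfold nat_id2; simpl.
  rewrite hcomp_unit_r; simpl; coe_norm.
  rewrite coe_id, vcomp_id_l; f_equal; apply coe_irrel.
Qed.

Lemma nat_comp_assoc F G H K (a : PseudoNat F G) (b : PseudoNat G H) (c : PseudoNat H K) :
  nat_comp a (nat_comp b c) = nat_comp (nat_comp a b) c.
Proof.
  apply nat_ext with (e := fun r => comp1_assoc (a r) (b r) (c r)
    : nat_comp a (nat_comp b c) r = nat_comp (nat_comp a b) c r).
  intros r s X; simpl; unfold nat_comp2; simpl; unfold nat_comp2.
  rewrite !lwhisker_vcomp, !rwhisker_vcomp.
  rewrite (hcomp_conj_l (N2 a X)), (hcomp_conj_l (id2 (a r)) (N2 b X)).
  rewrite (hcomp_conj_r (id2 (a r)) (id2 (b r))).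
  rewrite !hcomp_id; coe_norm.
  repeat (apply (f_equal2 vcomp); [reflexivity || apply coe_irrel |]); apply coe_irrel.
Qed.

End FunCat.

Definition FunData (C D : TwoCat) : TwoCatData := {|
  ob := PseudoFunctor C D;
  mor := PseudoNat;
  cell := fun F G a b => Modification a b;
  id1 := nat_id;
  comp1 := fun F G H a b => nat_comp a b;
  id2 := fun F G a => mod_id a;
  vcomp := fun F G a b c g f => mod_vcomp g f;
  hcomp := fun F G H a a' b b' f g => mod_hcomp f g
|}.

Lemma mod_coe {C D : TwoCat} {F G : FunData C D} {a b : mor F G} (p : a = b) (r : C) :
  M2 (coe p) r = coe (f_equal (fun n : PseudoNat F G => N1 n r) p).
Proof. destruct p; reflexivity. Qed.

Definition Fun (C D : TwoCat) : TwoCat.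
Proof.
  refine {| tcd := FunData C D;
            comp1_id_l := @nat_comp_id_l C D;
            comp1_id_r := @nat_comp_id_r C D;
            comp1_assoc := @nat_comp_assoc C D |}; intros; apply mod_ext; intro x; simpl.
  - apply vcomp_id_l.
  - apply vcomp_id_r.
  - apply vcomp_assoc.
  - apply hcomp_id.
  - apply hcomp_vcomp.
  - rewrite !mod_coe; simpl.
    rewrite (coe_irrel _ (comp1_id_l (N1 X x))), (coe_irrel _ (comp1_id_l (N1 Y x))).
    apply hcomp_id_l.
  - rewrite !mod_coe; simpl.
    rewrite (coe_irrel _ (comp1_id_r (N1 X x))), (coe_irrel _ (comp1_id_r (N1 Y x))).
    apply hcomp_id_r.
  - rewrite !mod_coe; simpl.
    rewrite (coe_irrel _ (comp1_assoc (N1 X x) (N1 Y x) (N1 Z x))).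
    rewrite (coe_irrel _ (comp1_assoc (N1 X' x) (N1 Y' x) (N1 Z' x))).
    apply hcomp_assoc.
Defined.

(* Main.v *)
From Stdlib Require Import IndefiniteDescription.
Require Import Defs.

(** Let a : F -> G be a pseudonatural transformation whose components have right
    duals n r := (a r)^* in D.  The only possible component at X : r -> s of a dual
    transformation is the mate of the inverse of a_X, obtained by bending its
    1-morphisms a_r and a_s around:
      G X n_s -> n_r a_r G X n_s -> n_r F X a_s n_s -> n_r F X.
    The snake equations in D make the mates natural and compatible with composition
    and units ([mate_lax]), and they make the units and counits of the componentwise
    duals into modifications ([mate_eta], [mate_eps]).  What they do not give is the
    invertibility of the mate.  This is where duals in C enter: a lax transformation b
    is automatically invertible at X as soon as X is the right dual of some Y, since
    pseudofunctors preserve duals and the mate of b_Y with respect to the dual pairs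
    (F X, F Y) and (G X, G Y) is then an inverse of b_X ([lax_invertible]).  Every X is
    the right dual of its own left dual, so left duals in C suffice.

    The statement about left duals follows by reversing 1-morphisms.  Left duals in C
    are right duals in [Op C], and a transformation F -> G becomes one from the opposite
    of G to the opposite of F once its components are inverted.

    All 2-dimensional calculations are carried out on 1-morphisms bracketed to the
    right.  A cell such as f : A B -> A' B' is replaced by the family of cells
    A (B W) -> A' (B' W) for all W.  For these families composition, whiskering and
    naturality are strict equations without associativity isomorphisms, and an equation
    of cells holds exactly when it holds after whiskering by all W, since W may be an
    identity. *)

Set Implicit Arguments.
Unset Strict Implicit.
Unset Printing Implicit Defensive.
Local Open Scope twocat_scope.

Local Notation "X ◁ f" := (id2 X ⊠ f) (at level 38, right associativity) : twocat_scope.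
Local Notation "f ▷ X" := (f ⊠ id2 X) (at level 37, left associativity) : twocat_scope.

(** * Chosen inverses *)

Section Inverses.
Context {D : TwoCat}.

Lemma invertible_monic {r s : D} {X Y Z : mor r s} {h : Y ⇒ Z} {f g : X ⇒ Y} :
  invertible h -> h ∘ f = h ∘ g -> f = g.
Proof.
  intros [k [E _]] H; rewrite <- (vcomp_id_l f), <- (vcomp_id_l g), <- E.
  now rewrite <- !vcomp_assoc, H.
Qed.

(** A chosen two-sided inverse: invertibility is only a proposition, whereas the
    component of the dual transformation has to be built from the inverse. *)
Definition inverse {r s : D} {X Y : mor r s} {f : X ⇒ Y} (H : invertible f) : Y ⇒ X :=
  proj1_sig (constructive_indefinite_description _ H).

Lemma inverse_l {r s : D} {X Y : mor r s} {f : X ⇒ Y} (H : invertible f) :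
  inverse H ∘ f = id2 X.
Proof. exact (proj1 (proj2_sig (constructive_indefinite_description _ H))). Qed.

Lemma inverse_r {r s : D} {X Y : mor r s} {f : X ⇒ Y} (H : invertible f) :
  f ∘ inverse H = id2 Y.
Proof. exact (proj2 (proj2_sig (constructive_indefinite_description _ H))). Qed.

Lemma inverse_invertible {r s : D} {X Y : mor r s} {f : X ⇒ Y} (H : invertible f) :
  invertible (inverse H).
Proof. exists f; split; [apply inverse_r | apply inverse_l]. Qed.

End Inverses.

(** * Whiskering up to rebracketing *)

Section Whiskering.
Context {D : TwoCat}.

(** The cell f' is f ▷ W with its source and target rebracketed.  The two equalities
    are hidden under an existential, so that no choice of bracketing ever has to be
    tracked; by proof irrelevance they do not affect f'. *)
Definition whiskers_to {r s t : D} {X Y : mor r s} (f : X ⇒ Y) (W : mor s t)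
  {X' Y' : mor r t} (f' : X' ⇒ Y') : Prop :=
  exists (p : X' = X ⊗ W) (q : Y ⊗ W = Y'), f' = coe q ∘ (f ▷ W) ∘ coe p.

Lemma whiskers_to_whisker {r s t : D} {X Y : mor r s} (f : X ⇒ Y) (W : mor s t) :
  whiskers_to f W (f ▷ W).
Proof. exists eq_refl, eq_refl; simpl; now rewrite vcomp_id_l, vcomp_id_r. Qed.

Lemma whiskers_to_coe {r s t : D} {X Y : mor r s} (e : X = Y) (W : mor s t)
  {X' Y' : mor r t} (e' : X' = Y') : X' = X ⊗ W -> whiskers_to (coe e) W (coe e').
Proof.
  intros p; destruct e, e'; exists p, (eq_sym p); simpl.
  rewrite hcomp_id, vcomp_id_r; now rewrite coe_vcomp_id.
Qed.

Lemma whiskers_to_coe_id {r s t : D} {X Y : mor r s} (e : X = Y) (W : mor s t) :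
  whiskers_to (coe e) W (id2 (Y ⊗ W)).
Proof. destruct e; exact (whiskers_to_coe eq_refl eq_refl eq_refl). Qed.

Lemma whiskers_to_id {r s t : D} (X : mor r s) (W : mor s t) {X' : mor r t} :
  X' = X ⊗ W -> whiskers_to (id2 X) W (id2 X').
Proof. exact (whiskers_to_coe eq_refl eq_refl). Qed.

Lemma whiskers_to_vcomp {r s t : D} {X Y Z : mor r s} {g : Y ⇒ Z} {f : X ⇒ Y} {W : mor s t}
  {X' Y' Z' : mor r t} {g' : Y' ⇒ Z'} {f' : X' ⇒ Y'} :
  whiskers_to g W g' -> whiskers_to f W f' -> whiskers_to (g ∘ f) W (g' ∘ f').
Proof.
  intros [p [q ->]] [p' [q' ->]]; exists p', q.
  rewrite rwhisker_vcomp; rassoc; f_equal; f_equal.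
  now rewrite !vcomp_assoc, coe_vcomp_id, vcomp_id_l.
Qed.

Lemma whiskers_to_coe_l {r s t : D} {X Y Z : mor r s} {f : X ⇒ Y} (e : Y = Z) {W : mor s t}
  {X' Y' : mor r t} {f' : X' ⇒ Y'} : whiskers_to f W f' -> whiskers_to (coe e ∘ f) W f'.
Proof. destruct e; simpl; now rewrite vcomp_id_l. Qed.

Lemma whiskers_to_coe_r {r s t : D} {X Y Z : mor r s} {f : Y ⇒ Z} (e : X = Y) {W : mor s t}
  {X' Y' : mor r t} {f' : X' ⇒ Y'} : whiskers_to f W f' -> whiskers_to (f ∘ coe e) W f'.
Proof. destruct e; simpl; now rewrite vcomp_id_r. Qed.

Lemma whiskers_to_coe_l_inv {r s t : D} {X Y : mor r s} {f : X ⇒ Y} {W : mor s t}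
  {X' Y' Z' : mor r t} {f' : X' ⇒ Y'} (e : Y' = Z') :
  whiskers_to f W f' -> whiskers_to f W (coe e ∘ f').
Proof. destruct e; simpl; now rewrite vcomp_id_l. Qed.

Lemma whiskers_to_coe_r_inv {r s t : D} {X Y : mor r s} {f : X ⇒ Y} {W : mor s t}
  {X' Y' Z' : mor r t} {f' : Y' ⇒ Z'} (e : X' = Y') :
  whiskers_to f W f' -> whiskers_to f W (f' ∘ coe e).
Proof. destruct e; simpl; now rewrite vcomp_id_r. Qed.

Lemma whiskers_to_hcomp {r s t u : D} {A B : mor r s} {X Y : mor s t} (g : A ⇒ B) {f : X ⇒ Y}
  {W : mor t u} {X' Y' : mor s u} {f' : X' ⇒ Y'} :
  whiskers_to f W f' -> whiskers_to (g ⊠ f) W (g ⊠ f').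
Proof.
  intros [p [q ->]]; subst X' Y'; simpl; rewrite vcomp_id_l, vcomp_id_r.
  exists (comp1_assoc _ _ _), (eq_sym (comp1_assoc _ _ _)).
  rewrite hcomp_conj_r; unfold asc, asci; now rassoc.
Qed.

(** The reason for right bracketing: a right whiskering is absorbed into W. *)
Lemma whiskers_to_rwhisker {r s t u : D} {X Y : mor r s} {f : X ⇒ Y} {V : mor s t}
  {W : mor t u} {X' Y' : mor r u} {f' : X' ⇒ Y'} :
  whiskers_to f (V ⊗ W) f' -> whiskers_to (f ▷ V) W f'.
Proof.
  intros [p [q ->]]; subst X' Y'; simpl; rewrite vcomp_id_l, vcomp_id_r.
  exists (comp1_assoc _ _ _), (eq_sym (comp1_assoc _ _ _)).
  rewrite <- hcomp_id, hcomp_conj_r; unfold asc, asci; now rassoc.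
Qed.

(** With [whiskers_to_inj], this lets an equation of cells be transported to an equation
    of rebracketed whiskerings and back. *)
Lemma whiskers_to_unique {r s t : D} {X Y : mor r s} {f : X ⇒ Y} {W : mor s t}
  {X' Y' : mor r t} {f' g' : X' ⇒ Y'} : whiskers_to f W f' -> whiskers_to f W g' -> f' = g'.
Proof.
  intros [p [q ->]] [p' [q' ->]].
  now rewrite (coe_irrel q q'), (coe_irrel p p').
Qed.

Lemma whiskers_to_unit {r s : D} {X Y : mor r s} (f : X ⇒ Y) : whiskers_to f (id1 s) f.
Proof.
  exists (eq_sym (comp1_id_r X)), (comp1_id_r Y).
  rewrite hcomp_id_r; rassoc; now rewrite coe_vcomp_id, vcomp_id_r.
Qed.

Lemma whiskers_to_invertible {r s t : D} {X Y : mor r s} {f : X ⇒ Y} {W : mor s t}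
  {X' Y' X'' Y'' : mor r t} {f' : X' ⇒ Y'} {f'' : X'' ⇒ Y''} :
  whiskers_to f W f' -> whiskers_to f W f'' -> invertible f' -> invertible f''.
Proof.
  intros [p [q ->]] [p' [q' ->]]; subst X' X'' Y' Y''; exact (fun H => H).
Qed.

Lemma whiskers_to_inj {r s : D} {X Y : mor r s} {f g : X ⇒ Y} {X' Y' : mor r s} {h : X' ⇒ Y'} :
  whiskers_to f (id1 s) h -> whiskers_to g (id1 s) h -> f = g.
Proof.
  intros [p [q E]] [p' [q' E']].
  assert (Q : X' = X) by (now rewrite p, comp1_id_r).
  assert (Q' : Y' = Y) by (now rewrite <- q, comp1_id_r).
  revert h p q p' q' E E'; subst X' Y'; intros h p q p' q' E E'.
  assert (K : forall k : X ⇒ Y, k = coe q ∘ (k ▷ id1 s) ∘ coe p).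
  { intros k; apply (whiskers_to_unique (whiskers_to_unit k)); now exists p, q. }
  rewrite (K f), (K g), <- E.
  now rewrite E', (coe_irrel q q'), (coe_irrel p p').
Qed.

(** The digits count the 1-morphisms, besides W, in the source and in the target. *)
Definition act22 {r s s' t u : D} {A : mor r s} {B : mor s t} {A' : mor r s'} {B' : mor s' t}
  (f : A ⊗ B ⇒ A' ⊗ B') (W : mor t u) : A ⊗ (B ⊗ W) ⇒ A' ⊗ (B' ⊗ W) :=
  asci A' B' W ∘ (f ▷ W) ∘ asc A B W.

Definition act21 {r s t u : D} {A : mor r s} {B : mor s t} {Z : mor r t}
  (f : A ⊗ B ⇒ Z) (W : mor t u) : A ⊗ (B ⊗ W) ⇒ Z ⊗ W := (f ▷ W) ∘ asc A B W.

Definition act01 {r t : D} {Z : mor r r} (f : id1 r ⇒ Z) (W : mor r t) : W ⇒ Z ⊗ W :=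
  (f ▷ W) ∘ luni W.

Definition act02 {r s u : D} {A : mor r s} {B : mor s r}
  (f : id1 r ⇒ A ⊗ B) (W : mor r u) : W ⇒ A ⊗ (B ⊗ W) :=
  asci A B W ∘ (f ▷ W) ∘ luni W.

Definition act20 {r s u : D} {A : mor r s} {B : mor s r}
  (f : A ⊗ B ⇒ id1 r) (W : mor r u) : A ⊗ (B ⊗ W) ⇒ W :=
  lun W ∘ (f ▷ W) ∘ asc A B W.

End Whiskering.

(** Identifies a rebracketed whiskering by recursion on the cell, discarding every
    coherence cell met on either side. *)
Ltac whiskers_to_step :=
  match goal with
  | |- whiskers_to (id2 _) _ (id2 _) => apply whiskers_to_id; rewrite ?comp1_assoc; reflexivity
  | |- whiskers_to (coe _) _ (id2 _) => apply whiskers_to_coe_id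
  | |- whiskers_to _ _ _ => apply whiskers_to_whisker
  | |- whiskers_to _ (id1 _) _ => apply whiskers_to_unit
  | |- whiskers_to (coe _ ∘ _) _ _ => apply whiskers_to_coe_l
  | |- whiskers_to (_ ∘ coe _) _ _ => apply whiskers_to_coe_r
  | |- whiskers_to _ _ (coe _ ∘ _) => apply whiskers_to_coe_l_inv
  | |- whiskers_to _ _ (_ ∘ coe _) => apply whiskers_to_coe_r_inv
  | |- whiskers_to (_ ∘ _) _ (_ ∘ _) => apply whiskers_to_vcomp
  | |- whiskers_to (_ ⊠ _) _ (_ ⊠ _) => apply whiskers_to_hcomp
  | |- whiskers_to (_ ▷ _) _ _ => apply whiskers_to_rwhisker
  end.

Ltac solve_whiskers_to :=
  intros; unfold act22, act21, act01, act02, act20, asc, asci, lun, luni, run, runi; rassoc;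
  repeat (rewrite (slide1 (coe_vcomp _ _)) || rewrite coe_vcomp); repeat whiskers_to_step.

Lemma whiskers_to_act22 {D : TwoCat} {r s s' t u : D} {A : mor r s} {B : mor s t} {A' : mor r s'}
  {B' : mor s' t} (f : A ⊗ B ⇒ A' ⊗ B') (W : mor t u) : whiskers_to f W (act22 f W).
Proof. solve_whiskers_to. Qed.

(** Proves an equation that is E whiskered by W and rebracketed. *)
Ltac by_whiskering E W :=
  intros; let H := fresh in pose proof E as H;
  match type of H with ?L = _ =>
    apply (whiskers_to_unique (f := L) (W := W)); [| rewrite H]; clear H; solve_whiskers_to end.

(** The converse: E is an instance, at an identity 1-morphism, of the whiskered form of
    the goal. *)
Ltac by_unwhiskering E :=
  intros; let H := fresh in pose proof E as H;
  match type of H with ?L = _ =>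
    apply (whiskers_to_inj (h := L)); [| rewrite H]; clear H; solve_whiskers_to end.

(** * Naturality of the rebracketed cells *)

Section Acting.
Context {D : TwoCat}.

Lemma act22_natural {r s s' t u : D} {A : mor r s} {B : mor s t} {A' : mor r s'}
  {B' : mor s' t} (f : A ⊗ B ⇒ A' ⊗ B') {W W' : mor t u} (h : W ⇒ W') :
  (A' ◁ B' ◁ h) ∘ act22 f W = act22 f W' ∘ (A ◁ B ◁ h).
Proof.
  unfold act22; rewrite (hcomp_conj_r (id2 A')), (hcomp_conj_r (id2 A)), !hcomp_id; rassoc.
  coe_norm; rewrite !coe_id, !vcomp_id_l; now rewrite (slide (whisker_exchange f h)).
Qed.

Lemma act21_natural {r s t u : D} {A : mor r s} {B : mor s t} {Z : mor r t}
  (f : A ⊗ B ⇒ Z) {W W' : mor t u} (h : W ⇒ W') :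
  (Z ◁ h) ∘ act21 f W = act21 f W' ∘ (A ◁ B ◁ h).
Proof.
  unfold act21; rewrite (hcomp_conj_r (id2 A)), !hcomp_id; rassoc.
  coe_norm; rewrite !coe_id, !vcomp_id_l; now rewrite (slide (whisker_exchange f h)).
Qed.

Lemma act01_natural {r t : D} {Z : mor r r} (f : id1 r ⇒ Z) {W W' : mor r t} (h : W ⇒ W') :
  (Z ◁ h) ∘ act01 f W = act01 f W' ∘ h.
Proof.
  unfold act01; rassoc; rewrite luni_nat; now rewrite (slide (whisker_exchange f h)).
Qed.

Lemma act02_natural {r s u : D} {A : mor r s} {B : mor s r} (f : id1 r ⇒ A ⊗ B)
  {W W' : mor r u} (h : W ⇒ W') : (A ◁ B ◁ h) ∘ act02 f W = act02 f W' ∘ h.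
Proof.
  unfold act02; rassoc; rewrite luni_nat, (hcomp_conj_r (id2 A)), !hcomp_id; rassoc.
  coe_norm; rewrite !coe_id, !vcomp_id_l; now rewrite (slide (whisker_exchange f h)).
Qed.

Lemma act20_natural {r s u : D} {A : mor r s} {B : mor s r} (f : A ⊗ B ⇒ id1 r)
  {W W' : mor r u} (h : W ⇒ W') : h ∘ act20 f W = act20 f W' ∘ (A ◁ B ◁ h).
Proof.
  unfold act20; rassoc; rewrite (hcomp_conj_r (id2 A)), !hcomp_id; rassoc.
  coe_norm; rewrite !coe_id, !vcomp_id_l, <- (slide (whisker_exchange f h)).
  rewrite hcomp_unit_l; coe_norm; now rewrite coe_id, vcomp_id_l.
Qed.

Lemma triangle_r {r s : D} {X : mor r s} (R : RightDual X) {t} (W : mor s t) :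
  act20 (rd_eps R) (X ⊗ W) ∘ (X ◁ act02 (rd_eta R) W) = id2 (X ⊗ W).
Proof. by_whiskering (rd_snake R) W. Qed.

Lemma triangle_l {r s : D} {X : mor r s} (R : RightDual X) {t} (W : mor r t) :
  (rdual R ◁ act20 (rd_eps R) W) ∘ act02 (rd_eta R) (rdual R ⊗ W) = id2 (rdual R ⊗ W).
Proof. by_whiskering (rd_snake' R) W. Qed.

Lemma act21_invertible {r s t u : D} {A : mor r s} {B : mor s t} {Z : mor r t}
  {f : A ⊗ B ⇒ Z} (W : mor t u) : invertible f -> invertible (act21 f W).
Proof.
  intros H; apply invertible_vcomp; [| apply coe_invertible].
  apply invertible_hcomp; [exact H | apply invertible_id].
Qed.

Lemma act01_invertible {r t : D} {Z : mor r r} {f : id1 r ⇒ Z} (W : mor r t) :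
  invertible f -> invertible (act01 f W).
Proof.
  intros H; apply invertible_vcomp; [| apply coe_invertible].
  apply invertible_hcomp; [exact H | apply invertible_id].
Qed.

Lemma invertible_of_act22 {r s s' t : D} {A : mor r s} {B : mor s t} {A' : mor r s'}
  {B' : mor s' t} (f : A ⊗ B ⇒ A' ⊗ B') : invertible (act22 f (id1 t)) -> invertible f.
Proof. apply (whiskers_to_invertible (f := f) (W := id1 t)); solve_whiskers_to. Qed.

Lemma act22_inverse {r s s' t u : D} {A : mor r s} {B : mor s t} {A' : mor r s'}
  {B' : mor s' t} {f : A ⊗ B ⇒ A' ⊗ B'} {g : A' ⊗ B' ⇒ A ⊗ B} (W : mor t u) :
  g ∘ f = id2 (A ⊗ B) -> act22 g W ∘ act22 f W = id2 (A ⊗ (B ⊗ W)).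
Proof.
  intros E; unfold act22; rassoc; coe_norm; rewrite coe_id, vcomp_id_l.
  rewrite (slide1 (eq_sym (rwhisker_vcomp W _ _))), E, hcomp_id, vcomp_id_l.
  apply coe_vcomp_id.
Qed.

Lemma whisker_square {r s t : D} (A : mor r s) {X Y Y' Z : mor s t}
  {g : Y ⇒ Z} {f : X ⇒ Y} {g' : Y' ⇒ Z} {f' : X ⇒ Y'} :
  g ∘ f = g' ∘ f' -> (A ◁ g) ∘ (A ◁ f) = (A ◁ g') ∘ (A ◁ f').
Proof. intros E; now rewrite <- !lwhisker_vcomp, E. Qed.

Lemma whisker_triangle {r s t : D} (A : mor r s) {X Y Z : mor s t}
  {g : Y ⇒ Z} {f : X ⇒ Y} {h : X ⇒ Z} : g ∘ f = h -> (A ◁ g) ∘ (A ◁ f) = A ◁ h.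
Proof. intros E; now rewrite <- lwhisker_vcomp, E. Qed.

End Acting.

(** * Pseudofunctors and the duals they preserve *)

Section PseudofunctorAction.
Context {C D : TwoCat} (F : PseudoFunctor C D).

Lemma F2_whisker_vcomp {r s : C} {X Y Z : mor r s} (g : Y ⇒ Z) (f : X ⇒ Y)
  {u} (W : mor (F s) u) : (F2 F g ▷ W) ∘ (F2 F f ▷ W) = F2 F (g ∘ f) ▷ W.
Proof. now rewrite F2_vcomp, rwhisker_vcomp. Qed.

Lemma Fm_natural {r s t : C} {X X' : mor r s} {Y Y' : mor s t} (f : X ⇒ X') (g : Y ⇒ Y')
  {u} (W : mor (F t) u) :
  (F2 F (f ⊠ g) ▷ W) ∘ act21 (Fm F X Y) W = act21 (Fm F X' Y') W ∘ (F2 F f ⊠ (F2 F g ▷ W)).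
Proof. by_whiskering (Fm_nat F f g) W. Qed.

Lemma Fm_natural_r {r s t : C} (X : mor r s) {Y Y' : mor s t} (g : Y ⇒ Y')
  {u} (W : mor (F t) u) :
  (F2 F (X ◁ g) ▷ W) ∘ act21 (Fm F X Y) W = act21 (Fm F X Y') W ∘ (F1 F X ◁ F2 F g ▷ W).
Proof. now rewrite Fm_natural, F2_id. Qed.

Lemma Fm_natural_l {r s t : C} {X X' : mor r s} (f : X ⇒ X') (Y : mor s t)
  {u} (W : mor (F t) u) :
  (F2 F (f ▷ Y) ▷ W) ∘ act21 (Fm F X Y) W
  = act21 (Fm F X' Y) W ∘ (F2 F f ▷ (F1 F Y ⊗ W)).
Proof. now rewrite Fm_natural, F2_id, hcomp_id. Qed.

Lemma Fm_associative {r s t u : C} (X : mor r s) (Y : mor s t) (Z : mor t u)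
  {v} (W : mor (F u) v) :
  act21 (Fm F (X ⊗ Y) Z) W ∘ act21 (Fm F X Y) (F1 F Z ⊗ W)
  = (F2 F (asc X Y Z) ▷ W) ∘ act21 (Fm F X (Y ⊗ Z)) W ∘ (F1 F X ◁ act21 (Fm F Y Z) W).
Proof. by_whiskering (Fm_assoc F X Y Z) W. Qed.

Lemma Fm_associative_inv {r s t u : C} (X : mor r s) (Y : mor s t) (Z : mor t u)
  {v} (W : mor (F u) v) :
  act21 (Fm F X (Y ⊗ Z)) W ∘ (F1 F X ◁ act21 (Fm F Y Z) W)
  = (F2 F (asci X Y Z) ▷ W) ∘ act21 (Fm F (X ⊗ Y) Z) W ∘ act21 (Fm F X Y) (F1 F Z ⊗ W).
Proof.
  rassoc; rewrite Fm_associative, !vcomp_assoc, F2_whisker_vcomp; unfold asc, asci.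
  now rewrite coe_vcomp_id, F2_id, hcomp_id, vcomp_id_l.
Qed.

Lemma Fm_left_unit {r s : C} (X : mor r s) {t} {W : mor (F s) t} {V} (k : V ⇒ F1 F X ⊗ W) :
  k = (F2 F (lun X) ▷ W) ∘ (act21 (Fm F (id1 r) X) W ∘ (act01 (Fu F r) (F1 F X ⊗ W) ∘ k)).
Proof.
  rewrite !vcomp_assoc, <- (vcomp_id_l k) at 1; f_equal; symmetry.
  by_whiskering (Fm_unit_l F X) W.
Qed.

(** Stated as an expansion of an arbitrary k, because the calculation of
    [image_triangle_l] starts by inserting the unit coherence in front of a composite. *)
Lemma Fm_right_unit {r s : C} (X : mor r s) {t} {W : mor (F s) t} {V} (k : V ⇒ F1 F X ⊗ W) :
  k = (F2 F (run X) ▷ W) ∘ (act21 (Fm F X (id1 s)) W ∘ ((F1 F X ◁ act01 (Fu F s) W) ∘ k)).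
Proof.
  rewrite !vcomp_assoc, <- (vcomp_id_l k) at 1; f_equal; symmetry.
  by_whiskering (Fm_unit_r F X) W.
Qed.

Lemma Fm_left_unit_inv {r s : C} (X : mor r s) {t} (W : mor (F s) t) :
  act21 (Fm F (id1 r) X) W ∘ act01 (Fu F r) (F1 F X ⊗ W) = F2 F (luni X) ▷ W.
Proof.
  rewrite <- (vcomp_id_r (F2 F (luni X) ▷ W)), (Fm_left_unit (id2 (F1 F X ⊗ W))).
  rewrite vcomp_assoc, F2_whisker_vcomp; unfold luni, lun.
  now rewrite coe_vcomp_id, F2_id, hcomp_id, vcomp_id_l, vcomp_id_r.
Qed.

End PseudofunctorAction.

Section Dual.
Context {C D : TwoCat} (F : PseudoFunctor C D).

(** Instead of the formulas for the unit h and the counit e of the dual pair of images,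
    which involve the inverses of the structure cells of F, the equations that determine
    h and e are assumed. *)
Context {r s : C} {Y : mor r s} (R : RightDual Y).
Context {h : id1 (F s) ⇒ F1 F (rdual R) ⊗ F1 F Y} {e : F1 F Y ⊗ F1 F (rdual R) ⇒ id1 (F r)}.
Context (Hh : Fm F (rdual R) Y ∘ h = F2 F (rd_eta R) ∘ Fu F s).
Context (He : Fu F r ∘ e = F2 F (rd_eps R) ∘ Fm F Y (rdual R)).

Lemma image_eta {u} (W : mor (F s) u) :
  act21 (Fm F (rdual R) Y) W ∘ act02 h W = (F2 F (rd_eta R) ▷ W) ∘ act01 (Fu F s) W.
Proof. by_whiskering Hh W. Qed.

Lemma image_eps {u} (W : mor (F r) u) :
  act01 (Fu F r) W ∘ act20 e W = (F2 F (rd_eps R) ▷ W) ∘ act21 (Fm F Y (rdual R)) W.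
Proof. by_whiskering He W. Qed.

(** Rewriting with the coherence of F moves everything under F, where the snake equation
    of R applies. *)
Lemma image_triangle_l {u} (W : mor (F r) u) :
  (F1 F (rdual R) ◁ act20 e W) ∘ act02 h (F1 F (rdual R) ⊗ W) = id2 (F1 F (rdual R) ⊗ W).
Proof.
  rewrite (Fm_right_unit (_ ∘ act02 h _)).
  rewrite (slide (whisker_square _ (image_eps _))).
  rewrite <- (slide (Fm_natural_r (rdual R) (rd_eps R) W)).
  rewrite (slide (Fm_associative_inv (rdual R) Y (rdual R) W)); rassoc.
  rewrite image_eta, <- (slide (Fm_natural_l (rd_eta R) (rdual R) W)), Fm_left_unit_inv.
  rewrite !F2_whisker_vcomp, !vcomp_assoc, rd_snake', F2_id; apply hcomp_id.
Qed.
End Dual.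

Lemma image_dual {C D : TwoCat} (F : PseudoFunctor C D) {r s : C} {Y : mor r s}
  (R : RightDual Y) :
  (exists h, Fm F (rdual R) Y ∘ h = F2 F (rd_eta R) ∘ Fu F s) /\
  (exists e, Fu F r ∘ e = F2 F (rd_eps R) ∘ Fm F Y (rdual R)).
Proof.
  destruct (Fm_inv F (rdual R) Y) as [m [_ Em]], (Fu_inv F r) as [u [_ Eu]]; split.
  - exists (m ∘ (F2 F (rd_eta R) ∘ Fu F s)); now rewrite vcomp_assoc, Em, vcomp_id_l.
  - exists (u ∘ (F2 F (rd_eps R) ∘ Fm F Y (rdual R))).
    now rewrite vcomp_assoc, Eu, vcomp_id_l.
Qed.

(** * Lax and colax transformations *)

Section Transformation.
Context {C D : TwoCat} {F G : PseudoFunctor C D}.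

(** The axioms of a pseudonatural transformation in rebracketed form, without
    invertibility of the components. *)
Record lax_transformation (n : forall r, mor (F r) (G r))
  (b : forall (r s : C) (X : mor r s), F1 F X ⊗ n s ⇒ n r ⊗ F1 G X) : Prop := {
  lax_natural : forall {r s : C} {X Y : mor r s} (f : X ⇒ Y) {u} (W : mor (G s) u),
    (n r ◁ (F2 G f ▷ W)) ∘ act22 (b r s X) W = act22 (b r s Y) W ∘ (F2 F f ▷ (n s ⊗ W));
  lax_composite : forall {r s t : C} (X : mor r s) (Y : mor s t) {u} (W : mor (G t) u),
    act22 (b r t (X ⊗ Y)) W ∘ act21 (Fm F X Y) (n t ⊗ W)
    = (n r ◁ act21 (Fm G X Y) W) ∘ act22 (b r s X) (F1 G Y ⊗ W)
      ∘ (F1 F X ◁ act22 (b s t Y) W);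
  lax_unit : forall (r : C) {u} (W : mor (G r) u),
    act22 (b r r (id1 r)) W ∘ act01 (Fu F r) (n r ⊗ W) = n r ◁ act01 (Fu G r) W
}.

(** The same axioms for components in the other direction, as satisfied by the inverses
    of the components of a pseudonatural transformation. *)
Record colax_transformation (n : forall r, mor (F r) (G r))
  (i : forall (r s : C) (X : mor r s), n r ⊗ F1 G X ⇒ F1 F X ⊗ n s) : Prop := {
  colax_natural : forall {r s : C} {X Y : mor r s} (f : X ⇒ Y) {u} (W : mor (G s) u),
    act22 (i r s Y) W ∘ (n r ◁ (F2 G f ▷ W)) = (F2 F f ▷ (n s ⊗ W)) ∘ act22 (i r s X) W;
  colax_composite : forall {r s t : C} (X : mor r s) (Y : mor s t) {u} (W : mor (G t) u),
    act22 (i r t (X ⊗ Y)) W ∘ (n r ◁ act21 (Fm G X Y) W)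
    = act21 (Fm F X Y) (n t ⊗ W)
      ∘ ((F1 F X ◁ act22 (i s t Y) W) ∘ act22 (i r s X) (F1 G Y ⊗ W));
  colax_unit : forall (r : C) {u} (W : mor (G r) u),
    act22 (i r r (id1 r)) W ∘ (n r ◁ act01 (Fu G r) W) = act01 (Fu F r) (n r ⊗ W)
}.

Lemma pseudonat_lax (a : PseudoNat F G) : lax_transformation (@N2 _ _ _ _ a).
Proof.
  split.
  - intros r s X Y f u W; by_whiskering (N2_nat a f) W.
  - intros r s t X Y u W; by_whiskering (N2_comp a X Y) W.
  - intros r u W; by_whiskering (N2_unit a r) W.
Qed.

Definition pseudonat_of_lax n b (L : @lax_transformation n b)
  (I : forall r s X, invertible (b r s X)) : PseudoNat F G.
Proof.
  refine {| N1 := n; N2 := b; N2_inv := I |}.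
  - intros r s X Y f; by_unwhiskering (lax_natural L f (id1 _)).
  - intros r s t X Y; by_unwhiskering (lax_composite L X Y (id1 _)).
  - intros r; by_unwhiskering (lax_unit L (id1 (G r))).
Defined.

End Transformation.

(** * Lax transformations are invertible at right duals *)

Section Invertibility.
Context {C D : TwoCat} {F G : PseudoFunctor C D} {n : forall r, mor (F r) (G r)}
  {b : forall (r s : C) (X : mor r s), F1 F X ⊗ n s ⇒ n r ⊗ F1 G X}.
Context (L : lax_transformation b).

Section Dual.
Context {r s : C} {Y : mor r s} (R : RightDual Y).
Local Notation X := (rdual R).
Context {hF : id1 (F s) ⇒ F1 F X ⊗ F1 F Y} {eF : F1 F Y ⊗ F1 F X ⇒ id1 (F r)}
  {hG : id1 (G s) ⇒ F1 G X ⊗ F1 G Y} {eG : F1 G Y ⊗ F1 G X ⇒ id1 (G r)}.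
Context (HhF : Fm F X Y ∘ hF = F2 F (rd_eta R) ∘ Fu F s).
Context (HeF : Fu F r ∘ eF = F2 F (rd_eps R) ∘ Fm F Y X).
Context (HhG : Fm G X Y ∘ hG = F2 G (rd_eta R) ∘ Fu G s).
Context (HeG : Fu G r ∘ eG = F2 G (rd_eps R) ∘ Fm G Y X).

(** Compatibility of b with the unit of the dual pair: by naturality at the unit of R,
    b commutes with its image, and b at an identity is given by the unit law. *)
Lemma lax_eta {u} (V : mor (G s) u) :
  act22 (b X) (F1 G Y ⊗ V) ∘ ((F1 F X ◁ act22 (b Y) V) ∘ act02 hF (n s ⊗ V))
  = n s ◁ act02 hG V.
Proof.
  apply (invertible_monic (h := n s ◁ act21 (Fm G X Y) V)).
  { apply invertible_hcomp; [apply invertible_id | apply act21_invertible, Fm_inv]. }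
  rewrite !vcomp_assoc, <- (lax_composite L X Y V), <- vcomp_assoc, (image_eta HhF).
  rewrite <- (slide (lax_natural L (rd_eta R) V)), (lax_unit L).
  rewrite <- !lwhisker_vcomp; f_equal; symmetry; apply image_eta, HhG.
Qed.

Lemma lax_eps {u} (V : mor (G r) u) :
  (n r ◁ act20 eG V) ∘ (act22 (b Y) (F1 G X ⊗ V) ∘ (F1 F Y ◁ act22 (b X) V))
  = act20 eF (n r ⊗ V).
Proof.
  apply (invertible_monic (h := n r ◁ act01 (Fu G r) V)).
  { apply invertible_hcomp; [apply invertible_id | apply act01_invertible, Fu_inv]. }
  rewrite (slide (whisker_square (n r) (image_eps HeG V))), (vcomp_assoc (n r ◁ act21 _ V)).
  rewrite <- (lax_composite L Y X V), <- (lax_unit L); rassoc.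
  rewrite (slide (lax_natural L (rd_eps R) V)), (image_eps HeF); reflexivity.
Qed.

(** The inverse of b X is the mate of b Y.  Each of the two composites reduces, by
    [lax_eps] or [lax_eta], to a triangle identity for the images of the dual pair. *)
Lemma lax_act_invertible {u} (W : mor (G r) u) : invertible (act22 (b X) W).
Proof.
  exists ((F1 F X ◁ n r ◁ act20 eG W) ∘ ((F1 F X ◁ act22 (b Y) (F1 G X ⊗ W))
            ∘ act02 hF (n s ⊗ (F1 G X ⊗ W)))); split; rassoc.
  - rewrite <- act02_natural, !vcomp_assoc, <- !lwhisker_vcomp.
    rewrite <- (vcomp_assoc (n r ◁ act20 eG W)), lax_eps.
    apply (image_triangle_l HhF HeF).
  - rewrite (vcomp_assoc (act22 (b X) W)), <- act22_natural; rassoc.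
    rewrite lax_eta, <- lwhisker_vcomp, <- hcomp_id; f_equal.
    apply (image_triangle_l HhG HeG).
Qed.
End Dual.

Lemma lax_invertible {r s : C} {Y : mor r s} (R : RightDual Y) : invertible (b (rdual R)).
Proof.
  destruct (image_dual F R) as [[hF HhF] [eF HeF]].
  destruct (image_dual G R) as [[hG HhG] [eG HeG]].
  apply invertible_of_act22, (lax_act_invertible HhF HeF HhG HeG).
Qed.
End Invertibility.

(** * Inverting the components *)

Section LaxColax.
Context {C D : TwoCat} {F G : PseudoFunctor C D} {n : forall r, mor (F r) (G r)}
  {b : forall (r s : C) (X : mor r s), F1 F X ⊗ n s ⇒ n r ⊗ F1 G X}
  {i : forall (r s : C) (X : mor r s), n r ⊗ F1 G X ⇒ F1 F X ⊗ n s}.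
Context (ib : forall (r s : C) (X : mor r s), i X ∘ b X = id2 (F1 F X ⊗ n s)).
Context (bi : forall (r s : C) (X : mor r s), b X ∘ i X = id2 (n r ⊗ F1 G X)).

Lemma act_ib {r s : C} (X : mor r s) {u} (W : mor (G s) u) :
  act22 (i X) W ∘ act22 (b X) W = id2 _.
Proof. apply act22_inverse, ib. Qed.

Lemma act_bi {r s : C} (X : mor r s) {u} (W : mor (G s) u) :
  act22 (b X) W ∘ act22 (i X) W = id2 _.
Proof. apply act22_inverse, bi. Qed.

Lemma cancel_b {r s : C} (X : mor r s) {u} {W : mor (G s) u} {V}
  {f g : V ⇒ F1 F X ⊗ (n s ⊗ W)} : act22 (b X) W ∘ f = act22 (b X) W ∘ g -> f = g.
Proof.
  apply invertible_monic; exists (act22 (i X) W); split; [apply act_ib | apply act_bi].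
Qed.

Lemma cancel_i {r s : C} (X : mor r s) {u} {W : mor (G s) u} {V}
  {f g : V ⇒ n r ⊗ (F1 G X ⊗ W)} : act22 (i X) W ∘ f = act22 (i X) W ∘ g -> f = g.
Proof.
  apply invertible_monic; exists (act22 (b X) W); split; [apply act_bi | apply act_ib].
Qed.

Lemma colax_of_lax : lax_transformation b -> colax_transformation i.
Proof.
  intros L; split.
  - intros r s X Y f u W; apply cancel_b; rewrite vcomp_assoc, act_bi, vcomp_id_l.
    rewrite vcomp_assoc, <- (lax_natural L), <- vcomp_assoc, act_bi.
    now rewrite vcomp_id_r.
  - intros r s t X Y u W; apply cancel_b; rewrite vcomp_assoc, act_bi, vcomp_id_l.
    rewrite vcomp_assoc, (lax_composite L); rassoc.
    rewrite (slide1 (whisker_triangle (F1 F X) (act_bi Y W))), hcomp_id, vcomp_id_l, act_bi.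
    now rewrite vcomp_id_r.
  - intros r u W; apply cancel_b; rewrite vcomp_assoc, act_bi, vcomp_id_l; symmetry.
    apply (lax_unit L).
Qed.

Lemma lax_of_colax : colax_transformation i -> lax_transformation b.
Proof.
  intros L; split.
  - intros r s X Y f u W; apply cancel_i; rewrite !vcomp_assoc, act_ib, vcomp_id_l.
    rewrite (colax_natural L); rassoc; now rewrite act_ib, vcomp_id_r.
  - intros r s t X Y u W; apply cancel_i; rewrite vcomp_assoc, act_ib, vcomp_id_l.
    rewrite !vcomp_assoc, (colax_composite L); rassoc.
    rewrite (slide1 (act_ib X _)), vcomp_id_l.
    now rewrite (whisker_triangle (F1 F X) (act_ib Y W)), hcomp_id, vcomp_id_r.
  - intros r u W; apply cancel_i; rewrite vcomp_assoc, act_ib, vcomp_id_l; symmetry.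
    apply (colax_unit L).
Qed.

End LaxColax.

(** * Mates of the inverse components *)

Section Mate.
Context {C D : TwoCat} {F G : PseudoFunctor C D} (a : PseudoNat F G).
Context (R : forall r, RightDual (a r)).
Local Notation i X := (inverse (N2_inv a X)).

Lemma inverse_colax : colax_transformation (fun r s X => i X).
Proof.
  apply (colax_of_lax (b := @N2 _ _ _ _ a)); try apply pseudonat_lax; intros.
  - apply inverse_l.
  - apply inverse_r.
Qed.

Local Notation n r := (rdual (R r)).

Definition mate {r s : C} (X : mor r s) : F1 G X ⊗ n s ⇒ n r ⊗ F1 F X :=
  (n r ◁ (run (F1 F X) ∘ (F1 F X ◁ rd_eps (R s)) ∘ asci (F1 F X) (a s) (n s)
          ∘ (i X ▷ n s) ∘ asc (a r) (F1 G X) (n s)))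
  ∘ asci (n r) (a r) (F1 G X ⊗ n s) ∘ (rd_eta (R r) ▷ (F1 G X ⊗ n s)) ∘ luni _.

(** The inverse component with only its target 1-morphism a s bent down.  Bending the
    source as well gives the mate, see [act_mate]. *)
Definition bend {r s : C} (X : mor r s) {u} (W : mor (F s) u) :
  a r ⊗ (F1 G X ⊗ (n s ⊗ W)) ⇒ F1 F X ⊗ W :=
  (F1 F X ◁ act20 (rd_eps (R s)) W) ∘ act22 (i X) (n s ⊗ W).

Lemma act_mate {r s : C} (X : mor r s) {u} (W : mor (F s) u) :
  act22 (mate X) W = (n r ◁ bend X W) ∘ act02 (rd_eta (R r)) (F1 G X ⊗ (n s ⊗ W)).
Proof.
  apply (whiskers_to_unique (f := mate X) (whiskers_to_act22 (mate X) W)).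
  unfold mate, bend; solve_whiskers_to.
Qed.

Lemma bend_whisker {r s : C} (X : mor r s) {u} {V W : mor (F s) u} (h : V ⇒ W) :
  bend X W ∘ (a r ◁ F1 G X ◁ n s ◁ h) = (F1 F X ◁ h) ∘ bend X V.
Proof.
  unfold bend; rassoc; rewrite <- act22_natural.
  now rewrite <- (slide (whisker_square (F1 F X) (act20_natural (rd_eps (R s)) h))).
Qed.

(** Straightening the bend. *)
Lemma bend_eta {r s : C} (X : mor r s) {u} (W : mor (G s) u) :
  bend X (a s ⊗ W) ∘ (a r ◁ F1 G X ◁ act02 (rd_eta (R s)) W) = act22 (i X) W.
Proof.
  unfold bend; rassoc; rewrite <- act22_natural.
  rewrite (slide1 (whisker_triangle (F1 F X) (triangle_r (R s) W))).
  now rewrite hcomp_id, vcomp_id_l.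
Qed.

Lemma bend_natural {r s : C} {X Y : mor r s} (f : X ⇒ Y) {u} (W : mor (F s) u) :
  bend Y W ∘ (a r ◁ (F2 G f ▷ (n s ⊗ W))) = (F2 F f ▷ W) ∘ bend X W.
Proof.
  unfold bend; rassoc; rewrite (colax_natural inverse_colax).
  now rewrite (slide (whisker_exchange _ _)).
Qed.

Lemma bend_composite {r s t : C} (X : mor r s) (Y : mor s t) {u} (W : mor (F t) u) :
  act21 (Fm F X Y) W ∘ ((F1 F X ◁ bend Y W) ∘ act22 (i X) (F1 G Y ⊗ (n t ⊗ W)))
  = bend (X ⊗ Y) W ∘ (a r ◁ act21 (Fm G X Y) (n t ⊗ W)).
Proof.
  unfold bend; rewrite lwhisker_vcomp; rassoc; rewrite (colax_composite inverse_colax).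
  now rewrite <- (slide (act21_natural (Fm F X Y) _)).
Qed.

Lemma mate_lax : lax_transformation (fun r s => @mate r s).
Proof.
  split.
  - intros r s X Y f u W; rewrite !act_mate; rassoc.
    rewrite <- act02_natural, (slide (whisker_square (n r) (bend_natural f W))).
    reflexivity.
  - intros r s t X Y u W; rewrite !act_mate, lwhisker_vcomp; rassoc.
    rewrite <- !(slide (act02_natural (rd_eta (R r)) _)), <- !act02_natural.
    rewrite (slide (whisker_square (n r) (bend_whisker X (bend Y W)))).
    rewrite (slide1 (whisker_triangle (n r) (bend_eta X _))).
    rewrite !vcomp_assoc, <- !lwhisker_vcomp, <- bend_composite; now rassoc.
  - intros r u W; rewrite !act_mate; rassoc.
    rewrite <- act02_natural; unfold bend; rewrite lwhisker_vcomp; rassoc.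
    rewrite (slide1 (whisker_triangle (n r) (colax_unit inverse_colax _))).
    rewrite (slide (whisker_square (n r) (act01_natural (Fu F r) _))).
    rewrite (triangle_l (R r) W), vcomp_id_r; reflexivity.
Qed.

(** The unit of the duals (a r, n r), whiskered by G X, passes through the mate followed by
    a: the bends straighten out, leaving the inverse of N2 a X next to N2 a X.  This is
    the modification axiom for the unit. *)
Lemma mate_eta {r s : C} (X : mor r s) {u} (W : mor (G s) u) :
  (n r ◁ act22 (N2 a X) W) ∘ (act22 (mate X) (a s ⊗ W) ∘ (F1 G X ◁ act02 (rd_eta (R s)) W))
  = act02 (rd_eta (R r)) (F1 G X ⊗ W).
Proof.
  rewrite act_mate; rassoc; rewrite <- act02_natural.
  rewrite (slide1 (whisker_triangle (n r) (bend_eta X W))).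
  rewrite (slide1 (whisker_triangle (n r) (act22_inverse W (inverse_r (N2_inv a X))))).
  now rewrite hcomp_id, vcomp_id_l.
Qed.

(** The modification axiom for the counit. *)
Lemma mate_eps {r s : C} (X : mor r s) {u} (W : mor (F s) u) :
  act20 (rd_eps (R r)) (F1 F X ⊗ W) ∘ ((a r ◁ act22 (mate X) W) ∘ act22 (N2 a X) (n s ⊗ W))
  = F1 F X ◁ act20 (rd_eps (R s)) W.
Proof.
  rewrite act_mate, lwhisker_vcomp; rassoc.
  rewrite <- (slide (act20_natural (rd_eps (R r)) (bend X W))).
  rewrite (slide1 (triangle_r (R r) _)), vcomp_id_l; unfold bend; rassoc.
  now rewrite (act22_inverse _ (inverse_l _)), vcomp_id_r.
Qed.
End Mate.

(** * Right duals of transformations *)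

(** The coherence cells of [Fun C D] are identity modifications along equalities of
    transformations; at r they are the coherence cells of D. *)
Ltac cells_at r :=
  unfold asc, asci, lun, luni, run, runi; simpl;
  repeat apply (f_equal2 vcomp); try reflexivity;
  match goal with |- M2 (coe ?p) _ = _ =>
    exact (eq_trans (@mod_coe _ _ _ _ _ _ p r) (coe_irrel _ _)) end.

Section ComponentwiseDuals.
Context {C D : TwoCat} {F G : PseudoFunctor C D} (a : PseudoNat F G) (b : PseudoNat G F).

Definition right_dual_of_components
  (eta : Modification (nat_id G) (nat_comp b a)) (eps : Modification (nat_comp a b) (nat_id F))
  (snake : forall r,
    lun (a r) ∘ (eps r ▷ a r) ∘ asc (a r) (b r) (a r) ∘ (a r ◁ eta r) ∘ runi (a r) = id2 (a r))
  (snake' : forall r,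
    run (b r) ∘ (b r ◁ eps r) ∘ asci (b r) (a r) (b r) ∘ (eta r ▷ b r) ∘ luni (b r) = id2 (b r)) :
  @RightDual (Fun C D) F G a.
Proof.
  refine (@Build_RightDual (Fun C D) F G a b eta eps _ _); apply mod_ext; intros r.
  - refine (eq_trans _ (snake r)); cells_at r.
  - refine (eq_trans _ (snake' r)); cells_at r.
Defined.

Definition left_dual_of_components
  (eta : Modification (nat_id F) (nat_comp a b)) (eps : Modification (nat_comp b a) (nat_id G))
  (snake : forall r,
    run (a r) ∘ (a r ◁ eps r) ∘ asci (a r) (b r) (a r) ∘ (eta r ▷ a r) ∘ luni (a r) = id2 (a r))
  (snake' : forall r,
    lun (b r) ∘ (eps r ▷ b r) ∘ asc (b r) (a r) (b r) ∘ (b r ◁ eta r) ∘ runi (b r) = id2 (b r)) :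
  @LeftDual (Fun C D) F G a.
Proof.
  refine (@Build_LeftDual (Fun C D) F G a b eta eps _ _); apply mod_ext; intros r.
  - refine (eq_trans _ (snake r)); cells_at r.
  - refine (eq_trans _ (snake' r)); cells_at r.
Defined.

End ComponentwiseDuals.

Section DualTransformation.
Context {C D : TwoCat} {F G : PseudoFunctor C D} (a : PseudoNat F G).
Context (R : forall r, RightDual (a r)).
Context (I : forall (r s : C) (X : mor r s), invertible (mate R X)).

Definition dual_nat : PseudoNat G F := pseudonat_of_lax (mate_lax R) I.

Definition dual_eta : Modification (nat_id G) (nat_comp dual_nat a).
Proof.
  refine {| M2 := fun r => rd_eta (R r) : nat_id G r ⇒ nat_comp dual_nat a r |}.
  intros r s X; simpl; unfold nat_comp2, nat_id2.
  by_unwhiskering (mate_eta R X (id1 (G s))).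
Defined.

Definition dual_eps : Modification (nat_comp a dual_nat) (nat_id F).
Proof.
  refine {| M2 := fun r => rd_eps (R r) : nat_comp a dual_nat r ⇒ nat_id F r |}.
  intros r s X; simpl; unfold nat_comp2, nat_id2; symmetry.
  by_unwhiskering (mate_eps R X (id1 (F s))).
Defined.

End DualTransformation.

Definition right_dual_of_left_dual {C : TwoCat} {r s : C} {X : mor r s} (L : LeftDual X) :
  RightDual (ldual L) :=
  {| rdual := X; rd_eta := ld_eta L; rd_eps := ld_eps L;
     rd_snake := ld_snake' L; rd_snake' := ld_snake L |}.

(** X is the right dual of its left dual, so invertibility of lax transformations at right
    duals applies to every X. *)
Lemma mate_invertible {C D : TwoCat} {F G : PseudoFunctor C D} {a : PseudoNat F G}
  (LC : forall (r s : C) (X : mor r s), LeftDual X) (R : forall r, RightDual (a r))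
  {r s : C} (X : mor r s) : invertible (mate R X).
Proof.
  exact (lax_invertible (mate_lax R) (right_dual_of_left_dual (LC _ _ X))).
Qed.

Lemma fun_has_right_duals (C D : TwoCat) :
  has_left_duals C -> has_right_duals D -> has_right_duals (Fun C D).
Proof.
  intros [LC] [RD]; constructor; intros F G a.
  pose (R r := RD _ _ (N1 a r)).
  pose (I r s X := @mate_invertible _ _ _ _ _ LC R r s X).
  apply (right_dual_of_components (b := dual_nat I) (eta := dual_eta I) (eps := dual_eps I)).
  - intros r; exact (rd_snake (R r)).
  - intros r; exact (rd_snake' (R r)).
Qed.

(** * Reversing 1-morphisms *)

Definition OpData (C : TwoCatData) : TwoCatData := {|
  ob := C;
  mor := fun r s => @mor C s r;
  cell := fun r s X Y => @cell C s r X Y;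
  id1 := @id1 C;
  comp1 := fun r s t X Y => @comp1 C t s r Y X;
  id2 := fun r s X => @id2 C s r X;
  vcomp := fun r s X Y Z g f => @vcomp C s r X Y Z g f;
  hcomp := fun r s t X X' Y Y' f g => @hcomp C t s r Y Y' X X' g f
|}.

Definition Op (C : TwoCat) : TwoCat.
Proof.
  refine {| tcd := OpData C;
    comp1_id_l := fun r s X => @comp1_id_r C s r X;
    comp1_id_r := fun r s X => @comp1_id_l C s r X;
    comp1_assoc := fun r s t u X Y Z => eq_sym (@comp1_assoc C u t s r Z Y X) |}.
  - intros r s; apply (@vcomp_id_l C s r).
  - intros r s; apply (@vcomp_id_r C s r).
  - intros r s; apply (@vcomp_assoc C s r).
  - intros r s t X Y; apply (@hcomp_id C t s r).
  - intros; apply (@hcomp_vcomp C t s r).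
  - intros r s; apply (@hcomp_id_r C s r).
  - intros r s; apply (@hcomp_id_l C s r).
  - intros; apply (@asci_nat C u t s r).
Defined.

Definition op_functor {C D : TwoCat} (F : PseudoFunctor C D) : PseudoFunctor (Op C) (Op D).
Proof.
  refine (@Build_PseudoFunctor (Op C) (Op D) (F0 F) (fun r s X => @F1 C D F s r X)
    (fun r s X Y f => @F2 C D F s r X Y f) (fun r s t X Y => @Fm C D F t s r Y X) (@Fu C D F)
    _ _ _ _ _ _ _ _).
  - intros; apply (@F2_id C D F).
  - intros; apply (@F2_vcomp C D F).
  - intros; apply (@Fm_inv C D F).
  - intros; apply (@Fu_inv C D F).
  - intros; apply (@Fm_nat C D F).
  - assert (E : forall (u t s r : C) (Z : mor u t) (Y : mor t s) (X : mor s r),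
      Fm F Z (Y ⊗ X) ∘ (F1 F Z ◁ Fm F Y X) ∘ asci (F1 F Z) (F1 F Y) (F1 F X)
      = F2 F (asci Z Y X) ∘ Fm F (Z ⊗ Y) X ∘ (Fm F Z Y ▷ F1 F X)).
    { intros u t s r Z Y X; by_unwhiskering (Fm_associative_inv (F := F) Z Y X (id1 _)). }
    intros; apply E.
  - intros; apply (@Fm_unit_r C D F).
  - intros; apply (@Fm_unit_l C D F).
Defined.

Lemma op_asci {C : TwoCat} {r s t u : C} (X : mor r s) (Y : mor s t) (Z : mor t u) :
  @asci (Op C) u t s r Z Y X = asc X Y Z.
Proof. apply (@coe_irrel C). Qed.

Section OpNat.
Context {C D : TwoCat} {F G : PseudoFunctor C D}.

Lemma colax_closed {n} {i : forall (r s : C) (X : mor r s), n r ⊗ F1 G X ⇒ F1 F X ⊗ n s} :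
  colax_transformation i <->
  (forall (r s : C) (X Y : mor r s) (f : X ⇒ Y),
     (F2 F f ▷ n s) ∘ i r s X = i r s Y ∘ (n r ◁ F2 G f)) /\
  (forall (r s t : C) (X : mor r s) (Y : mor s t),
     i r t (X ⊗ Y) ∘ (n r ◁ Fm G X Y)
     = (Fm F X Y ▷ n t) ∘ asc (F1 F X) (F1 F Y) (n t) ∘ (F1 F X ◁ i s t Y)
       ∘ asci (F1 F X) (n s) (F1 G Y) ∘ (i r s X ▷ F1 G Y) ∘ asc (n r) (F1 G X) (F1 G Y)) /\
  (forall r : C, i r r (id1 r) ∘ (n r ◁ Fu G r) = (Fu F r ▷ n r) ∘ luni (n r) ∘ run (n r)).
Proof.
  split.
  - intros L; repeat split.
    + symmetry; by_unwhiskering (colax_natural L f (id1 _)).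
    + intros r s t X Y; by_unwhiskering (colax_composite L X Y (id1 _)).
    + intros r; by_unwhiskering (colax_unit L (id1 (G r))).
  - intros [E1 [E2 E3]]; split.
    + intros r s X Y f u W; symmetry; by_whiskering (E1 r s X Y f) W.
    + intros r s t X Y u W; by_whiskering (E2 r s t X Y) W.
    + intros r u W; by_whiskering (E3 r) W.
Qed.

(** Reversing 1-morphisms swaps the tensor factors of the source and of the target of a
    component, so a pseudonatural transformation in the opposite sense is an invertible
    colax one. *)
Definition op_nat n i (L : @colax_transformation C D F G n i)
  (I : forall r s X, invertible (i r s X)) : PseudoNat (op_functor G) (op_functor F).
Proof.
  refine (@Build_PseudoNat (Op C) (Op D) (op_functor G) (op_functor F) n
    (fun r s X => i s r X) (fun r s X => I s r X) _ _ _);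
  destruct (proj1 colax_closed L) as [E1 [E2 E3]].
  - intros r s; apply E1.
  - intros r s t X Y; rewrite !op_asci; apply E2.
  - exact E3.
Defined.

Lemma op_nat_colax (b : PseudoNat (op_functor G) (op_functor F)) :
  @colax_transformation C D F G b (fun r s X => @N2 _ _ _ _ b s r X).
Proof.
  apply colax_closed; repeat split.
  - intros r s X Y f; exact (N2_nat b f).
  - intros r s t X Y; refine (eq_trans (@N2_comp _ _ _ _ b t s r Y X) _).
    now rewrite !op_asci.
  - intros r; exact (N2_unit b r).
Qed.
End OpNat.

(** * Left duals of transformations *)

Section OppositeDuals.
Context {C : TwoCat} {r s : C} {X : mor r s}.

Definition op_right_dual (L : LeftDual X) : @RightDual (Op C) s r X.
Proof.
  refine (@Build_RightDual (Op C) s r X (ldual L) (ld_eta L) (ld_eps L) _ _).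
  - exact (ld_snake L).
  - rewrite op_asci; exact (ld_snake' L).
Defined.

Definition op_left_dual (R : RightDual X) : @LeftDual (Op C) s r X.
Proof.
  refine (@Build_LeftDual (Op C) s r X (rdual R) (rd_eta R) (rd_eps R) _ _).
  - rewrite op_asci; exact (rd_snake R).
  - exact (rd_snake' R).
Defined.

End OppositeDuals.

Section InverseCells.
Context {D : TwoCat}.

(** A modification of transformations is also one of their inverse components. *)
Lemma modification_of_inverse {r s s' t : D} {A : mor r s} {B : mor s' t}
  {x y : mor s t} {x' y' : mor r s'} {a : A ⊗ x ⇒ x' ⊗ B} {b : A ⊗ y ⇒ y' ⊗ B}
  {a' : x' ⊗ B ⇒ A ⊗ x} {b' : y' ⊗ B ⇒ A ⊗ y} {f : x ⇒ y} {f' : x' ⇒ y'} :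
  a' ∘ a = id2 (A ⊗ x) -> b ∘ b' = id2 (y' ⊗ B) ->
  b' ∘ (f' ▷ B) = (A ◁ f) ∘ a' -> b ∘ (A ◁ f) = (f' ▷ B) ∘ a.
Proof.
  intros Ea Eb E; rewrite <- (vcomp_id_r (A ◁ f)), <- Ea, (vcomp_assoc (A ◁ f)), <- E.
  now rewrite !vcomp_assoc, Eb, vcomp_id_l.
Qed.

Context {p q r p' q' r' : D} {A : mor p p'} {B : mor q q'} {E : mor r r'}
  {x : mor p' q'} {x' : mor p q} {y : mor q' r'} {y' : mor q r}
  {f : A ⊗ x ⇒ x' ⊗ B} {f' : x' ⊗ B ⇒ A ⊗ x} {g : B ⊗ y ⇒ y' ⊗ E} {g' : y' ⊗ E ⇒ B ⊗ y}.

(** [paste] is the component of a composite transformation and [paste'] the component of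
    the opposite composite.  The doubled [eq_sym] is the associativity of the opposite
    2-category. *)
Let paste := asc x' y' E ∘ (x' ◁ g) ∘ asci x' B y ∘ (f ▷ y) ∘ asc A x y.
Let paste' := @asci D _ _ _ _ A x y ∘ (f' ▷ y) ∘ coe (eq_sym (eq_sym (comp1_assoc x' B y)))
   ∘ (x' ◁ g') ∘ asci x' y' E.

Lemma pasting_inverse : f ∘ f' = id2 _ -> g ∘ g' = id2 _ -> paste ∘ paste' = id2 _.
Proof.
  intros Ef Eg; unfold paste, paste'; rassoc; coe_norm; rewrite coe_id, vcomp_id_l.
  rewrite (slide1 (eq_sym (rwhisker_vcomp y f f'))), Ef, hcomp_id, vcomp_id_l.
  rewrite (slide1 (coe_vcomp_id _ _)), vcomp_id_l.
  rewrite (slide1 (whisker_triangle x' Eg)), hcomp_id, vcomp_id_l; apply coe_vcomp_id.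
Qed.

Lemma pasting_inverse' : f' ∘ f = id2 _ -> g' ∘ g = id2 _ -> paste' ∘ paste = id2 _.
Proof.
  intros Ef Eg; unfold paste, paste'; rassoc; coe_norm; rewrite coe_id, vcomp_id_l.
  rewrite (slide1 (whisker_triangle x' Eg)), hcomp_id, vcomp_id_l.
  rewrite (slide1 (coe_vcomp_id _ _)), vcomp_id_l.
  rewrite (slide1 (eq_sym (rwhisker_vcomp y f' f))), Ef, hcomp_id, vcomp_id_l.
  apply coe_vcomp_id.
Qed.

Lemma unit_inverse (X : mor p q) :
  (runi X ∘ lun X) ∘ (luni X ∘ run X) = id2 _ /\ (luni X ∘ run X) ∘ (runi X ∘ lun X) = id2 _.
Proof. split; rassoc; coe_solve. Qed.
End InverseCells.

Section Opposition.
Context {C D : TwoCat} {F G : PseudoFunctor C D}.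

Definition op_transformation (a : PseudoNat F G) :
  PseudoNat (op_functor G) (op_functor F) :=
  op_nat (inverse_colax a) (fun r s X => inverse_invertible (N2_inv a X)).

Definition unop_transformation (b : PseudoNat (op_functor F) (op_functor G)) :
  PseudoNat G F.
Proof.
  refine (@pseudonat_of_lax C D G F b
    (fun (r s : C) (X : mor r s) => @inverse D _ _ _ _ _ (@N2_inv _ _ _ _ b s r X)) _ _).
  - apply (lax_of_colax (i := fun (r s : C) (X : mor r s) => @N2 _ _ _ _ b s r X));
      [| | apply op_nat_colax]; intros; [apply (@inverse_r D) | apply (@inverse_l D)].
  - intros; apply (@inverse_invertible D).
Defined.

Context {a : PseudoNat F G} {b : PseudoNat (op_functor F) (op_functor G)}.

Definition unop_eta
  (m : Modification (nat_id (op_functor F)) (nat_comp b (op_transformation a))) :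
  Modification (nat_id F) (nat_comp a (unop_transformation b)).
Proof.
  refine {| M2 := (fun r : C => M2 m r)
              : forall r : C, nat_id F r ⇒ nat_comp a (unop_transformation b) r |}.
  intros r s X.
  refine (@modification_of_inverse D (F r) (F s) (F r) (F s) (F1 F X) (F1 F X) _ _ _ _ _ _
    (@N2 _ _ _ _ (nat_id (op_functor F)) s r X)
    (@N2 _ _ _ _ (nat_comp b (op_transformation a)) s r X) _ _ _ _ _).
  - apply (proj1 (unit_inverse (F1 F X))).
  - cbn [N2 nat_comp]; unfold nat_comp2.
    exact (@pasting_inverse D (F r) (G r) (F r) (F s) (G s) (F s) (F1 F X) (F1 G X) (F1 F X)
      (a s) (a r) (b s) (b r) (N2 a X) (inverse (N2_inv a X))
      (N2 (unop_transformation b) X) (@N2 _ _ _ _ b s r X)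
      (inverse_r _) (@inverse_l D _ _ _ _ _ _)).
  - exact (@M2_nat _ _ _ _ _ _ m s r X).
Defined.

Definition unop_eps
  (m : Modification (nat_comp (op_transformation a) b) (nat_id (op_functor G))) :
  Modification (nat_comp (unop_transformation b) a) (nat_id G).
Proof.
  refine {| M2 := (fun r : C => M2 m r)
              : forall r : C, nat_comp (unop_transformation b) a r ⇒ nat_id G r |}.
  intros r s X.
  refine (@modification_of_inverse D (G r) (G s) (G r) (G s) (F1 G X) (F1 G X) _ _ _ _ _ _
    (@N2 _ _ _ _ (nat_comp (op_transformation a) b) s r X)
    (@N2 _ _ _ _ (nat_id (op_functor G)) s r X) _ _ _ _ _).
  - cbn [N2 nat_comp]; unfold nat_comp2.
    exact (@pasting_inverse' D (G r) (F r) (G r) (G s) (F s) (G s) (F1 G X) (F1 F X) (F1 G X)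
      (b s) (b r) (a s) (a r) (N2 (unop_transformation b) X)
      (@N2 _ _ _ _ b s r X) (N2 a X) (inverse (N2_inv a X))
      (@inverse_r D _ _ _ _ _ _) (inverse_l _)).
  - apply (proj2 (unit_inverse (F1 G X))).
  - exact (@M2_nat _ _ _ _ _ _ m s r X).
Defined.

End Opposition.

Lemma fun_has_left_duals (C D : TwoCat) :
  has_right_duals C -> has_left_duals D -> has_left_duals (Fun C D).
Proof.
  intros [RC] [LD]; constructor; intros F G a.
  pose (L r := LD _ _ (N1 a r)).
  pose (LC (r s : Op C) (X : mor r s) := op_left_dual (RC s r X)).
  pose (R (r : Op C) := op_right_dual (L r)
    : @RightDual (Op D) (op_functor G r) (op_functor F r) (op_transformation a r)).
  pose (I r s X := @mate_invertible _ _ _ _ _ LC R r s X).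
  apply (left_dual_of_components (b := unop_transformation (dual_nat I))
    (eta := unop_eta (dual_eta I)) (eps := unop_eps (dual_eps I))).
  - intros r; exact (ld_snake (L r)).
  - intros r; exact (ld_snake' (L r)).
Qed.

Theorem corollary3p4 (C D : TwoCat) :
  (has_left_duals C -> has_right_duals D -> has_right_duals (Fun C D)) /\
  (has_right_duals C -> has_left_duals D -> has_left_duals (Fun C D)).
Proof. split; [apply fun_has_right_duals | apply fun_has_left_duals]. Qed.
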